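(* Let $p(\cdot),q(\cdot):\mathbb{R}^n\to[1,\infty]$ be measurable functions satisfying $1<p_-,\,q_-,\,p_+,\,q_+<\infty$, and suppose that at least one of the following three conditions holds (inequalities between exponents being understood almost everywhere): (1) $1\le q(\cdot)\le p(\cdot)\le\infty$; (2) $p_-\ge 1$ and $q(\cdot)=q_+=q_-\ge 1$ is constant; (3) $\frac{1}{p(\cdot)}+\frac{1}{q(\cdot)}\le 1$. Then the (topological) dual space $(\ell^{q(\cdot)}(L^{p(\cdot)}))^*$ is canonically isomorphic to the Köthe dual $(\ell^{q(\cdot)}(L^{p(\cdot)}))'$; that is, the canonical map sending $g=(g_\nu)_{\nu=1}^\infty\in(\ell^{q(\cdot)}(L^{p(\cdot)}))'$ to the functional $$f=(f_\nu)_{\nu=1}^\infty\longmapsto\sum_{\nu=1}^\infty\int_{\mathbb{R}^n}f_\nu(x)g_\nu(x)\,dx$$ is an isomorphism of normed spaces from $(\ell^{q(\cdot)}(L^{p(\cdot)}))'$ onto $(\ell^{q(\cdot)}(L^{p(\cdot)}))^*$.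
   Context: For a measurable function $p(\cdot)$ on $\mathbb{R}^n$ write $p_+:=\operatorname{ess\,sup}p(\cdot)$ and $p_-:=\operatorname{ess\,inf}p(\cdot)$ (similarly $q_\pm$). Functions are complex-valued and measurable on $\mathbb{R}^n$, identified when equal almost everywhere. Variable Lebesgue space. For a measurable exponent $p(\cdot):\mathbb{R}^n\to[1,\infty]$ put $\Omega_\infty=\{x: p(x)=\infty\}$, $\Omega_0=\mathbb{R}^n\setminus\Omega_\infty$ and $$\varrho_{p(\cdot)}(f):=\int_{\Omega_0}|f(x)|^{p(x)}\,dx+\|f\|_{L^\infty(\Omega_\infty)}.$$ $L^{p(\cdot)}$ consists of all measurable $f$ such that $\varrho_{p(\cdot)}(\lambda^{-1}f)<\infty$ for some $\lambda>0$, with norm $\|f\|_{L^{p(\cdot)}}:=\inf\{\lambda>0:\varrho_{p(\cdot)}(\lambda^{-1}f)\le1\}$. The conjugate exponent $p'(\cdot)$ is defined by $\frac1{p(x)}+\frac1{p'(x)}=1$; when $1<p_-\le p_+<\infty$ the dual $(L^{p(\cdot)})^*$ is identified (up to equivalent norms) with $L^{p'(\cdot)}$ via the pairing $\int_{\mathbb{R}^n}f(x)g(x)\,dx$. Variable mixed space. For a sequence $f=(f_\nu)_{\nu=1}^\infty$ in $L^{p(\cdot)}$ define $$\varrho_{\ell^{q(\cdot)}(L^{p(\cdot)})}(f):=\sum_{\nu=1}^\infty\inf\Big\{\lambda_\nu>0:\varrho_{p(\cdot)}\big(\lambda_\nu^{-1/q(\cdot)}|f_\nu|\big)\le1\Big\}\in[0,\infty],$$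 with the convention $\lambda^{1/\infty}=1$. The space $\ell^{q(\cdot)}(L^{p(\cdot)})$ consists of all such $f$ for which $\varrho_{\ell^{q(\cdot)}(L^{p(\cdot)})}(\lambda^{-1}f)<\infty$ for some $\lambda>0$, and is equipped with $\|f\|_{\ell^{q(\cdot)}(L^{p(\cdot)})}:=\inf\{\lambda>0:\varrho_{\ell^{q(\cdot)}(L^{p(\cdot)})}(\lambda^{-1}f)\le1\}$, which is known to be a norm under any one of conditions (1), (2), (3). Köthe dual. $(\ell^{q(\cdot)}(L^{p(\cdot)}))'$ is the space of all sequences $g=(g_\nu)_{\nu=1}^\infty$ in $L^{p'(\cdot)}$ such that $\sum_{\nu=1}^\infty\left|\int_{\mathbb{R}^n}f_\nu(x)g_\nu(x)\,dx\right|<\infty$ for every $(f_\nu)_{\nu=1}^\infty\in\ell^{q(\cdot)}(L^{p(\cdot)})$; equivalently, such that $\sum_{\nu=1}^\infty f_\nu g_\nu\in L^1$ for every $(f_\nu)_{\nu=1}^\infty\in\ell^{q(\cdot)}(L^{p(\cdot)})$. Its norm is $$\|g\|_{(\ell^{q(\cdot)}(L^{p(\cdot)}))'}:=\sup\Big\{\sum_{\nu=1}^\infty\Big|\int_{\mathbb{R}^n}f_\nu g_\nu\,dx\Big|:\|(f_\nu)_{\nu=1}^\infty\|_{\ell^{q(\cdot)}(L^{p(\cdot)})}\le1\Big\}=\sup\Big\{\Big\|\sum_{\nu=1}^\infty f_\nu g_\nu\Big\|_{L^1}:\|(f_\nu)_{\nu=1}^\infty\|_{\ell^{q(\cdot)}(L^{p(\cdot)})}\le1\Big\}.$$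 The dual space $(\ell^{q(\cdot)}(L^{p(\cdot)}))^*$ is the space of bounded linear functionals with the operator norm. *)

(* Defs.v *)
From HB Require Import structures.
From mathcomp Require Import all_boot all_order all_algebra.
From mathcomp Require Import all_classical all_reals all_analysis.
From mathcomp Require Import measurable_realfun ess_sup_inf complex.

Set Implicit Arguments.
Unset Strict Implicit.
Unset Printing Implicit Defensive.

Import Order.TTheory GRing.Theory Num.Theory.
Import numFieldNormedType.Exports.
Import ComplexField.

Local Open Scope classical_set_scope.
Local Open Scope ring_scope.
Local Open Scope ereal_scope.

(* R^n with its Borel sigma-algebra (the product of n copies of the Borel
   sigma-algebra of R). Measurable functions are Borel measurable; since
   functions are identified almost everywhere and every Lebesgue measurable
   function agrees almost everywhere with a Borel one, no generality is lost. *)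
Notation Rn R n := (n.-tuple (measurableTypeR R)).

Lemma product_measure1_sigma_finite d1 d2 (T1 : measurableType d1)
    (T2 : measurableType d2) (R : realType)
    (m1 : {sigma_finite_measure set T1 -> \bar R})
    (m2 : {sigma_finite_measure set T2 -> \bar R}) :
  sigma_finite setT (m1 \x m2).
Proof.
have /sigma_finiteP[F [TF ndF Foo]] := sigma_finiteT m1.
have /sigma_finiteP[G [TG ndG Goo]] := sigma_finiteT m2.
exists (fun n => F n `*` G n).
  rewrite -setXTT TF TG predeqE => -[x y]; split.
    move=> [/= [n _ Fnx] [k _ Gky]]; exists (maxn n k) => //; split.
    - by move: x Fnx; exact/subsetPset/ndF/leq_maxl.
    - by move: y Gky; exact/subsetPset/ndG/leq_maxr.
  by move=> [n _ []/= ? ?]; split; exists n.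
move=> k; have [? ?] := Foo k; have [? ?] := Goo k.
split; first exact: measurableX.
by rewrite product_measure1E// lte_mul_pinfty// ge0_fin_numE.
Qed.

Section lebesgue_cons.
Context (R : realType) (n : nat).
Variable mu : {sigma_finite_measure set (Rn R n) -> \bar R}.

Definition tuple_cons (x : measurableTypeR R * Rn R n) : Rn R n.+1 :=
  [tuple of x.1 :: x.2].

Lemma measurable_tuple_cons : measurable_fun setT tuple_cons.
Proof. exact: measurable_cons. Qed.

Definition lebesgue_cons : set (Rn R n.+1) -> \bar R :=
  pushforward (@lebesgue_measure R \x mu) tuple_cons.

Let lebesgue_cons0 : lebesgue_cons set0 = 0.
Proof. by rewrite /lebesgue_cons /pushforward preimage_set0 measure0. Qed.

Let lebesgue_cons_ge0 A : 0 <= lebesgue_cons A.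
Proof. by rewrite /lebesgue_cons /pushforward measure_ge0. Qed.

Let lebesgue_cons_sigma_additive : semi_sigma_additive lebesgue_cons.
Proof.
move=> F mF tF mUF; rewrite /lebesgue_cons /pushforward preimage_bigcup.
have mpre A : measurable A -> measurable (tuple_cons @^-1` A).
  by move=> mA; rewrite -[X in measurable X]setTI; exact: measurable_tuple_cons.
apply: measure_semi_sigma_additive.
- by move=> k; exact: mpre.
- apply/trivIsetP => /= i j _ _ ij; rewrite -preimage_setI.
  by move/trivIsetP : tF => /(_ _ _ _ _ ij) ->//; rewrite preimage_set0.
- by rewrite -preimage_bigcup; exact: mpre.
Qed.

HB.instance Definition _ := isMeasure.Build _ _ _ lebesgue_cons
  lebesgue_cons0 lebesgue_cons_ge0 lebesgue_cons_sigma_additive.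

Lemma measurable_thead_behead :
  measurable_fun setT (fun t : Rn R n.+1 => (thead t, [tuple of behead t])).
Proof.
apply/measurable_fun_pairP; split => /=; first exact: measurable_tnth.
exact: measurable_behead.
Qed.

Let lebesgue_cons_sigma_finite : sigma_finite setT lebesgue_cons.
Proof.
have [F TF Foo] := product_measure1_sigma_finite (@lebesgue_measure R) mu.
pose u t : measurableTypeR R * Rn R n := (thead t, [tuple of behead t]).
have consK x : u (tuple_cons x) = x.
  case: x => a t; rewrite /u /tuple_cons /= theadE.
  by congr pair; exact/val_inj.
exists (fun i => u @^-1` F i); first by rewrite -preimage_bigcup -TF.
move=> i; have [mFi Fioo] := Foo i; split.
  rewrite -[X in measurable X]setTI; exact: measurable_thead_behead.
rewrite /lebesgue_cons /pushforward (_ : _ @^-1` _ = F i)//.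
by apply/seteqP; split => x /=; rewrite consK.
Qed.

HB.instance Definition _ := Measure_isSigmaFinite.Build _ _ _ lebesgue_cons
  lebesgue_cons_sigma_finite.

End lebesgue_cons.

(* n-dimensional Lebesgue measure: the n-fold product of the one-dimensional
   one, carried to n-tuples by (x, t) |-> x :: t; see [lebesgue_Rn_box]. *)
Fixpoint lebesgue_Rn (R : realType) n :
    {sigma_finite_measure set (Rn R n) -> \bar R} :=
  match n with
  | 0 => \d_([tuple] : Rn R 0)
  | m.+1 => lebesgue_cons (lebesgue_Rn R m)
  end.

Lemma lebesgue_Rn_box (R : realType) n (A : 'I_n -> set (measurableTypeR R)) :
  (forall i, measurable (A i)) ->
  lebesgue_Rn R n [set t | forall i, A i (tnth t i)] =
  \prod_(i < n) lebesgue_measure (A i).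
Proof.
elim: n A => [|n IH] A mA.
  rewrite big_ord0 /= diracE mem_set//; by case.
rewrite big_ord_recl /= -IH//.
rewrite /lebesgue_cons /pushforward.
rewrite (_ : _ @^-1` _ = A ord0 `*`
    [set t | forall i, A (lift ord0 i) (tnth t i)]); last first.
  apply/seteqP; split => -[a t] /=.
    move=> At; split; first by have := At ord0; rewrite tnth0.
    by move=> i; have := At (lift ord0 i); rewrite tnthS.
  move=> [A0 At] i; case: (unliftP ord0 i) => [j ->|->]; last by rewrite tnth0.
  by rewrite tnthS.
rewrite product_measure1E//.
rewrite (_ : [set t | _] = \bigcap_(i in [set: 'I_n])
    ((fun t : Rn R n => tnth t i) @^-1` A (lift ord0 i))); last first.
  by apply/seteqP; split => t /= At i => [_|]; exact: At.
apply: fin_bigcap_measurable; first exact: finite_finset.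
move=> i _; rewrite -[X in measurable X]setTI.
exact: (measurable_tnth i).
Qed.

Section complex_functions.
Context (R : realType) (n : nat).
Local Notation mu := (lebesgue_Rn R n).
Implicit Type f : Rn R n -> R[i].

Definition cmeasurable f :=
  measurable_fun setT (fun x => complex.Re (f x)) /\
  measurable_fun setT (fun x => complex.Im (f x)).

Definition cintegral f : R[i] :=
  Complex (\int[mu]_x complex.Re (f x))%R (\int[mu]_x complex.Im (f x))%R.

(* Sum of a complex series, meaningful when both parts converge. *)
Definition cseries_sum (u : nat -> R[i]) : R[i] :=
  Complex (limn (series (fun k => complex.Re (u k))))
          (limn (series (fun k => complex.Im (u k)))).

End complex_functions.

(* A normed space over R[i] given by representatives: the vectors are the
   elements of [ns_mem] inside the ambient module [ns_vec], and two of them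
   denote the same vector when they are related by [ns_eq]. *)
Record normed_space (R : realType) := NormedSpace {
  ns_vec : lmodType R[i] ;
  ns_mem : set ns_vec ;
  ns_eq : ns_vec -> ns_vec -> Prop ;
  ns_norm : ns_vec -> \bar R }.

Section normed_space.
Context (R : realType).
Implicit Types X Y : normed_space R.

Definition bounded_linear X (L : ns_vec X -> R[i]) : Prop :=
  (forall (a : R[i]) x y, ns_mem x -> ns_mem y ->
     L (a *: x + y)%R = (a * L x + L y)%R) /\
  exists C : R, forall x, ns_mem x -> (Normc.normc (L x))%:E <= C%:E * ns_norm x.

Definition topological_dual X : normed_space R := {|
  ns_vec := ns_vec X -> R[i] ;
  ns_mem := [set L | bounded_linear L] ;
  ns_eq := fun L M => forall x, ns_mem x -> L x = M x ;
  ns_norm := fun L => ereal_sup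
    [set (Normc.normc (L x))%:E | x in [set x | ns_mem x /\ ns_norm x <= 1]] |}.

Record normed_space_iso X Y (phi : ns_vec X -> ns_vec Y) : Prop := {
  iso_mem : forall x, ns_mem x -> ns_mem (phi x) ;
  iso_eq : forall x y, ns_mem x -> ns_mem y ->
    ns_eq x y -> ns_eq (phi x) (phi y) ;
  iso_linear : forall (a : R[i]) x y, ns_mem x -> ns_mem y ->
    ns_eq (phi (a *: x + y)%R) (a *: phi x + phi y)%R ;
  iso_inj : forall x y, ns_mem x -> ns_mem y ->
    ns_eq (phi x) (phi y) -> ns_eq x y ;
  iso_surj : forall y, ns_mem y -> exists2 x, ns_mem x & ns_eq (phi x) y ;
  iso_bounded : exists2 C : R, (0 < C)%R &
    forall x, ns_mem x -> ns_norm (phi x) <= C%:E * ns_norm x ;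
  iso_inv_bounded : exists2 C : R, (0 < C)%R &
    forall x, ns_mem x -> ns_norm x <= C%:E * ns_norm (phi x) }.

End normed_space.

Section variable_exponent_spaces.
Context (R : realType) (n : nat).
Local Notation mu := (lebesgue_Rn R n).
Implicit Types p q : Rn R n -> \bar R.

Definition modular_Lp p (f : Rn R n -> R[i]) : \bar R :=
  \int[mu]_(x in [set x | p x != +oo]) ((Normc.normc (f x)) `^ fine (p x))%:E +
  'N[mu]_+oo [ (fun x => (Normc.normc (f x))%:E) \_ [set x | p x = +oo] ].

Definition Lp_mem p : set (Rn R n -> R[i]) := [set f |
  cmeasurable f /\
  exists2 l : R, (0 < l)%R & modular_Lp p (l^-1%:C%C *: f)%R < +oo].

Definition conjugate_exponent p : Rn R n -> \bar R :=
  fun x => hoelder_conjugate (p x).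

(* Sequences are indexed from 0 instead of 1. *)
Definition fseq : lmodType R[i] := nat -> Rn R n -> R[i].

(* In \bar R the inverse of +oo is 0, whence l^(1/oo) = 1. *)
Definition modular_lqLp p q (f : fseq) : \bar R :=
  \sum_(nu <oo) ereal_inf [set l%:E | l in [set l : R | (0 < l)%R /\
    modular_Lp p
      (fun x => (l `^ (- fine (q x)^-1%E) * Normc.normc (f nu x))%:C%C) <= 1]].

Definition norm_lqLp p q (f : fseq) : \bar R :=
  ereal_inf [set l%:E | l in [set l : R | (0 < l)%R /\
    modular_lqLp p q (l^-1%:C%C *: f)%R <= 1]].

Definition fseq_ae_eq (f g : fseq) : Prop :=
  forall nu, {ae mu, forall x, f nu x = g nu x}.

Definition lqLp p q : normed_space R := {|
  ns_vec := fseq ;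
  ns_mem := [set f | (forall nu, Lp_mem p (f nu)) /\
    exists2 l : R, (0 < l)%R & modular_lqLp p q (l^-1%:C%C *: f)%R < +oo] ;
  ns_eq := fseq_ae_eq ;
  ns_norm := norm_lqLp p q |}.

Definition pairing (f g : fseq) (nu : nat) : R[i] :=
  cintegral (fun x => f nu x * g nu x)%R.

Definition abs_pairing (f g : fseq) : \bar R :=
  \sum_(nu <oo) (Normc.normc (pairing f g nu))%:E.

Definition koethe_dual p q : normed_space R := {|
  ns_vec := fseq ;
  ns_mem := [set g | (forall nu, Lp_mem (conjugate_exponent p) (g nu)) /\
    forall f : fseq, @ns_mem _ (lqLp p q) f -> abs_pairing f g < +oo] ;
  ns_eq := fseq_ae_eq ;
  ns_norm := fun g => ereal_sup [set abs_pairing f g | f in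
    [set f : fseq | @ns_mem _ (lqLp p q) f /\ norm_lqLp p q f <= 1]] |}.

Definition canonical_map (g : fseq) : fseq -> R[i] :=
  fun f => cseries_sum (pairing f g).

End variable_exponent_spaces.

(* Main.v *)
(* Continuity on the Koethe side: if g were not bounded on the unit ball, pick
   f^k in the ball whose pairings with g sum to more than k 4^k. A majorant F of
   all the 4^-k |f^k| still has finite modular, and F times the phases of g
   contradicts g being in the Koethe dual.

   Onto: a bounded functional on a single component is absolutely continuous
   with respect to Lebesgue measure once tested against w 1_B for an integrable
   weight w > 0, so Radon-Nikodym gives a density; testing against the
   truncations of |g|^(p'-1) sgn g puts it in L^{p'}. Since q is bounded, finitely
   supported sequences are dense, so the densities represent the functional.

   The norms agree because multiplying f_nu by the phase of its pairing with
   g_nu keeps the norm of f and makes all pairings nonnegative. *)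
From HB Require Import structures.
Require Import Defs.
From mathcomp Require Import all_boot all_order all_algebra.
From mathcomp Require Import all_classical all_reals all_analysis.
From mathcomp Require Import measurable_realfun ess_sup_inf complex.
From mathcomp Require Import ring lra.

Set Implicit Arguments.
Unset Strict Implicit.
Unset Printing Implicit Defensive.

Import Order.TTheory GRing.Theory Num.Theory.
Import numFieldNormedType.Exports.

Local Open Scope classical_set_scope.
Local Open Scope ring_scope.

(** * Variable exponent modular *)

(** The estimates run on modulars, not on norms. Exponents at least 1 give [rho (c u) <= c rho u]
    for [c <= 1]; bounded exponents give [rho (m u) <= m^pM rho u] for [m >= 1]; the mixed modular
    obeys the same two rules with [qM]. Hence the norm is at most 1 plus the modular, and a bounded
    functional on one component satisfies [|l u| <= A (1 + rho u)]. This affine bound does not tend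
    to 0 with u, but homogeneity repairs it: used at [m u] and divided by m it reads
    [|l u| <= (A / m) (1 + m^pM rho u)], which is small for m large and then the modular small
    enough. Dominated convergence on one component and the vanishing of a functional on tails both
    rest on this. The damping by powers of 4 is a product of two powers of 2: one makes the scaling
    parameters of the mixed modular summable over k, the other the modulars. The exponents enter
    through representatives P and Q that are finite and bounded everywhere and agree with p and q
    almost everywhere. *)

Lemma nneseries_half (R : realType) :
  (\sum_(0 <= k <oo) ((2 ^+ k.+1)^-1 : R)%:E)%E = 1%E.
Proof.
transitivity (\sum_(0 <= k <oo) ((1 : R) / (2 ^ (k + 1))%:R)%:E)%E.
  by apply: eq_eseriesr => k _; rewrite addn1 natrX div1r.
apply: cvg_lim => //.
have /= := @cvg_geometric_eseries_half R 1 0.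
by rewrite expr0 divr1.
Qed.

(** * A positive integrable weight on a sigma-finite space *)

Section weight.
Context d (T : measurableType d) (R : realType).
Variable mu : {sigma_finite_measure set T -> \bar R}.

(** Stands in for the constant 1, which has infinite modular on a space of infinite measure. Since
    [0 < w <= 1], the weight lies in the variable Lebesgue space for any measurable bounded exponent
    that is at least 1, and dividing by it is harmless. *)
Lemma sigma_finite_weight : exists w : T -> R,
  [/\ measurable_fun setT w, forall x, 0 < w x <= 1 &
      (\int[mu]_x (w x)%:E < +oo)%E].
Proof.
have [F TF Foo] := sigma_finiteT mu.
(* Dividing by [1 + mu (F k)] gives both [c k <= 2^-(k+1)] and [c k * mu (F k) <= 2^-(k+1)], so the
   same series bounds W pointwise and in integral. *)
pose c k : R := (2 ^+ k.+1)^-1 / (1 + fine (mu (F k))).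
have f0 k : 0 <= fine (mu (F k)) by rewrite fine_ge0.
have c0 k : 0 < c k.
  by rewrite divr_gt0// ?invr_gt0 ?exprn_gt0// ltr_pwDl.
pose W x := (\sum_(0 <= k <oo) (c k * \1_(F k) x)%:E)%E.
have W0 k x : (0 <= (c k * \1_(F k) x)%:E)%E.
  by rewrite lee_fin mulr_ge0// ltW.
have W1 x : (W x <= 1)%E.
  rewrite -(nneseries_half R); apply: lee_nneseries => // k _.
  rewrite lee_fin -[leRHS]mulr1 ler_pM ?(ltW (c0 _))//.
    by rewrite ler_pdivrMr ?ltr_pwDl// ler_peMr ?lerDl.
have Wfin x : W x \is a fin_num.
  rewrite ge0_fin_numE ?nneseries_ge0//.
  by rewrite (le_lt_trans (W1 x)) ?ltry.
have mW : measurable_fun setT W.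
  apply: ge0_emeasurable_sum => // k _.
  apply/measurable_EFinP; apply: measurable_funM => //.
  exact/measurable_indic/(Foo k).1.
exists (fine \o W); split.
- exact: (measurableT_comp (fine_measurable measurableT) mW).
- move=> x; rewrite -!lte_fin -lee_fin /= fineK// W1 andbT.
  have : setT x by [].
  rewrite TF => -[k _ Fkx].
  apply: (@lt_le_trans _ _ (c k * \1_(F k) x)%:E).
    by rewrite indicE mem_set//= mulr1 lte_fin.
  apply: (@le_trans _ _ (\sum_(0 <= i < k.+1) (c i * \1_(F i) x)%:E)%E); last first.
    by apply: nneseries_lim_ge => i *; exact: W0.
  by rewrite big_nat_recr//= leeDr// sume_ge0.
- rewrite (eq_integral W); last by move=> x _ /=; rewrite fineK.
  rewrite integral_nneseries//=; last first.
    move=> k; apply/measurable_EFinP; apply: measurable_funM => //.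
    exact/measurable_indic/(Foo k).1.
  apply: (@le_lt_trans _ _ 1%E); last by rewrite ltry.
  rewrite -(nneseries_half R); apply: lee_nneseries => [k _ _|k _]; first exact: integral_ge0.
  under eq_integral do rewrite EFinM.
  rewrite ge0_integralZl_EFin//; first last.
  - exact: ltW.
  - exact/measurable_EFinP/measurable_indic/(Foo k).1.
  have mFk := (Foo k).1.
  rewrite integral_indic// setIT.
  have muFk := (Foo k).2.
  rewrite -[X in (_ * X)%E]fineK ?ge0_fin_numE//.
  rewrite -EFinM lee_fin /c -mulrA ler_piMr ?invr_ge0 ?exprn_ge0//.
  by rewrite mulrC ler_pdivrMr ?ltr_pwDl// mul1r lerDr.
Qed.

End weight.

Lemma measurable_powR_fun d (T : measurableType d) (R : realType)
    (D : set T) (u v : T -> R) : measurable D ->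
  measurable_fun D u -> measurable_fun D v ->
  measurable_fun D (fun x => u x `^ v x).
Proof.
move=> mD mu mv.
rewrite /powR; apply: measurable_fun_if => //.
- exact: measurable_fun_eqr.
- have mb : measurable_fun D (fun x => v x == 0) by exact: measurable_fun_eqr.
  apply: (@measurable_funS _ _ _ _ D) => //.
  have -> : (fun x => (v x == 0)%:R : R) = (fun b : bool => b%:R : R) \o (fun x => v x == 0) by [].
  exact: measurableT_comp.
- apply: (@measurable_funS _ _ _ _ D) => //.
  apply: measurableT_comp; first exact: measurable_expR.
  by apply: measurable_funM => //; exact: measurableT_comp.
Qed.

(** The modular for an exponent that is finite everywhere; [modular_LpE] reduces [modular_Lp] to
    it. *)
HB.lock Definition rho d (T : measurableType d) (R : realType)
    (mu : {measure set T -> \bar R}) (P u : T -> R) : \bar R :=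
  \int[mu]_x (`|u x| `^ P x)%:E.

Section modular.
Context d (T : measurableType d) (R : realType).
Variables (mu : {measure set T -> \bar R}) (P : T -> R).
Implicit Types (u v w : T -> R) (c m : R).

Local Notation rho := (rho mu P).

Lemma rhoE u : rho u = (\int[mu]_x (`|u x| `^ P x)%:E)%E.
Proof. by rewrite rho.unlock. Qed.

Lemma rho_ge0 u : (0 <= rho u)%E.
Proof. by rewrite rhoE; apply: integral_ge0 => x _; rewrite lee_fin powR_ge0. Qed.

Hypothesis mP : measurable_fun setT P.

Lemma measurable_rho u : measurable_fun setT u ->
  measurable_fun setT (fun x => (`|u x| `^ P x)%:E).
Proof.
move=> mu'; apply/measurable_EFinP; apply: measurable_powR_fun => //.
exact: measurableT_comp.
Qed.

Variable pM : R.
Hypothesis PM : forall x, 1 <= P x <= pM.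

Let P_ge0 x : 0 <= P x.
Proof. by have /andP[/(le_trans ler01)] := PM x. Qed.

Let P_neq0 x : P x != 0.
Proof. by rewrite gt_eqF//; have /andP[/(lt_le_trans ltr01)] := PM x. Qed.

Lemma rho0 : rho (cst 0) = 0%E.
Proof.
rewrite rhoE; under eq_integral do rewrite normr0 powR0//.
exact: integral0.
Qed.

Lemma le_rho u v : measurable_fun setT u -> measurable_fun setT v ->
  (forall x, `|u x| <= `|v x|) -> (rho u <= rho v)%E.
Proof.
move=> mu' mv uv; rewrite !rhoE; apply: ge0_le_integral => //.
- exact: measurable_rho.
- exact: measurable_rho.
- by move=> x _; rewrite lee_fin ge0_ler_powR// nnegrE.
Qed.

(** Because [1 <= P], the power [c^P] is at most c. *)
Lemma rhoZ_le u c : measurable_fun setT u -> 0 <= c <= 1 ->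
  (rho (fun x => c * u x)%R <= c%:E * rho u)%E.
Proof.
move=> mu' /andP[]; rewrite !rhoE le_eqVlt => /predU1P[<- _|c0 c1].
  under eq_integral do rewrite mul0r normr0 powR0//.
  by rewrite integral0 mul0e.
rewrite -ge0_integralZl_EFin//; [|exact: measurable_rho|exact: ltW].
apply: ge0_le_integral => //.
- by apply: measurable_rho; exact: measurable_funM.
- by apply: measurable_funeM; exact: measurable_rho.
- move=> x _; rewrite -EFinM lee_fin normrM (ger0_norm (ltW c0)).
  by rewrite ge1r_powRZ ?c0//; case/andP: (PM x).
Qed.

(** Boundedness of the exponent enters here, as [m^P <= m^pM]. It makes finiteness of the modular
    stable under scaling, so that [Lrho] is a linear space. *)
Lemma rhoZ_ge u m : measurable_fun setT u -> 1 <= m ->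
  (rho (fun x => (m * u x)%R) <= (m `^ pM)%:E * rho u)%E.
Proof.
move=> mu' m1; have m0 := le_trans ler01 m1; rewrite !rhoE.
rewrite -ge0_integralZl_EFin//; [|exact: measurable_rho|exact: powR_ge0].
apply: ge0_le_integral => //.
- by apply: measurable_rho; exact: measurable_funM.
- by apply: measurable_funeM; exact: measurable_rho.
- move=> x _; rewrite -EFinM lee_fin normrM (ger0_norm m0) powRM//.
  by rewrite ler_wpM2r ?powR_ge0// ler_powR//; case/andP: (PM x).
Qed.

(** [|u + v|] is at most twice the maximum of [|u|] and [|v|], and a power of the maximum is at most
    the sum of the powers. *)
Lemma rhoD_le u v : measurable_fun setT u -> measurable_fun setT v ->
  (rho (fun x => u x + v x)%R <= (2 `^ pM)%:E * (rho u + rho v))%E.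
Proof.
move=> mu' mv.
pose w x := Num.max `|u x| `|v x|.
have mw : measurable_fun setT w.
  by apply: measurable_maxr; exact: measurableT_comp.
apply: (@le_trans _ _ (rho (fun x => 2 * w x))).
  apply: le_rho.
  - exact: measurable_funD.
  - exact: measurable_funM.
  - move=> x; rewrite (le_trans (ler_normD _ _))// normrM (ger0_norm (ler0n _ 2)).
    rewrite (@ger0_norm _ (w x)) /w ?le_max ?normr_ge0//.
    by rewrite mulr2n mulrDl mul1r lerD// le_max lexx ?orbT.
apply: (le_trans (rhoZ_ge mw _)); first by rewrite ler1n.
rewrite lee_wpmul2l ?lee_fin ?powR_ge0//.
rewrite !rhoE -ge0_integralD//; [|exact: measurable_rho..].
apply: ge0_le_integral => //.
- exact: measurable_rho.
- by apply: emeasurable_funD; exact: measurable_rho.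
- move=> x _; rewrite -EFinD lee_fin /w.
  by rewrite (fun_if (fun r => `|r|)) !normr_id; case: ifP => _; rewrite ?lerDl ?lerDr ?powR_ge0.
Qed.

Definition Lrho : set (T -> R) :=
  [set u | measurable_fun setT u /\ (rho u < +oo)%E].

Lemma le_Lrho u v : measurable_fun setT u -> Lrho v ->
  (forall x, `|u x| <= `|v x|) -> Lrho u.
Proof. by move=> mu' [mv voo] uv; split => //; exact: le_lt_trans (le_rho _ _ uv) voo. Qed.

Lemma LrhoZ u c : Lrho u -> Lrho (fun x => c * u x).
Proof.
move=> [mu' uoo]; have [c1|c1] := leP `|c| 1.
  by apply: (@le_Lrho _ u) => //; [exact: measurable_funM|
    move=> x; rewrite normrM ler_piMl].
split; first exact: measurable_funM.
have -> : rho (fun x => c * u x) = rho (fun x => `|c| * u x).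
  by rewrite !rhoE; apply: eq_integral => x _; rewrite !normrM normr_id.
apply: le_lt_trans (rhoZ_ge mu' (ltW c1)) _.
by rewrite lte_mul_pinfty ?lee_fin ?powR_ge0.
Qed.

Lemma LrhoD u v : Lrho u -> Lrho v -> Lrho (fun x => u x + v x).
Proof.
move=> [mu' uoo] [mv voo]; split; first exact: measurable_funD.
apply: le_lt_trans (rhoD_le mu' mv) _.
by rewrite lte_mul_pinfty ?lee_fin ?powR_ge0// lte_add_pinfty.
Qed.

Lemma Lrho0 : Lrho (cst 0).
Proof. by split => //; rewrite rho0 ltry. Qed.

Lemma Lrho_norm u : Lrho u -> Lrho (fun x => `|u x|).
Proof.
move=> uL; apply: (@le_Lrho _ u) => //; first exact: measurableT_comp uL.1.
by move=> x; rewrite normr_id.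
Qed.

Lemma Lrho_indic u A : measurable A -> Lrho u -> Lrho (fun x => u x * \1_A x).
Proof.
move=> mA uL; apply: (@le_Lrho _ u) => //.
  by apply: measurable_funM; [exact: uL.1|exact: measurable_indic].
by move=> x; rewrite normrM ler_piMr// indicE; case: (_ \in _); rewrite ?normr0 ?normr1.
Qed.

(** For values in ]0, 1] and [1 <= P], raising to the power P only decreases. *)
Lemma le1_Lrho w : measurable_fun setT w -> (forall x, 0 < w x <= 1) ->
  (\int[mu]_x (w x)%:E < +oo)%E -> Lrho w.
Proof.
move=> mw w01 woo; split => //; apply: le_lt_trans woo; rewrite rhoE.
apply: ge0_le_integral => //.
- exact: measurable_rho.
- exact/measurable_EFinP.
- move=> x _; rewrite lee_fin; have /andP[w0 w1] := w01 x.
  by rewrite gtr0_norm// ge1r_powR ?w0//; case/andP: (PM x).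
Qed.

End modular.

(** * Duality of a single variable Lebesgue space *)

Lemma measurable_funV d (T : measurableType d) (R : realType) (u : T -> R) :
  measurable_fun setT u -> (forall x, 0 <= u x) ->
  measurable_fun setT (fun x => (u x)^-1).
Proof.
move=> mu u0; rewrite (_ : (fun _ => _) = (fun x => u x `^ (-1))).
  exact: (measurableT_comp (measurable_powR (-1)) mu).
by apply/funext => x; rewrite powR_inv1.
Qed.

Lemma indicU_disj (T : Type) (R : realType) (A B : set T) : A `&` B = set0 ->
  (\1_(A `|` B) : T -> R) = \1_A \+ \1_B.
Proof.
move=> AB; apply/funext => x /=; rewrite !indicE in_setU.
case: (boolP (x \in A)) => [xA|_]; last by rewrite add0r.
case: (boolP (x \in B)) => [xB|_]; last by rewrite addr0.
have : (A `&` B) x by split; [rewrite inE in xA|rewrite inE in xB].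
by rewrite AB.
Qed.

(** Once the terms are below 1, their p-th powers are squeezed between 0 and the terms. *)
Lemma cvg_powR0 (R : realType) (p : R) (z : nat -> R) : 1 <= p ->
  (forall k, 0 <= z k) -> z @ \oo --> 0 -> (fun k => z k `^ p) @ \oo --> 0.
Proof.
move=> p1 z0 zc; apply: (@squeeze_cvgr _ _ _ _ (cst 0) z) => //; last exact: cvg_cst.
have : \forall k \near \oo, `|z k| < 1 by apply: (@cvgr0_norm_lt _ _ _ _ _ z).
apply: filterS => k; rewrite ger0_norm// => zk1; rewrite powR_ge0/=.
have [->|z0k] := eqVneq (z k) 0; first by rewrite powR0// gt_eqF// (lt_le_trans _ p1).
by rewrite ge1r_powR// lt0r z0k z0/= ltW.
Qed.

Section representation.
Context d (T : measurableType d) (R : realType).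
Variables (mu : {sigma_finite_measure set T -> \bar R}) (P : T -> R) (pM : R).
Hypothesis mP : measurable_fun setT P.
Hypothesis PM : forall x, 1 <= P x <= pM.
Variables (l : (T -> R) -> R) (A : R).
Implicit Types (u v : T -> R) (c m : R).

Local Notation rho := (rho mu P).
Local Notation Lrho := (Lrho mu P).

Hypothesis l_lin : forall c u v, Lrho u -> Lrho v ->
  l (fun x => c * u x + v x) = c * l u + l v.
Hypothesis A_ge0 : 0 <= A.
Hypothesis l_bnd : forall u, Lrho u -> `|l u| <= A * (1 + fine (rho u)).

Let L0 : Lrho (cst 0). Proof. exact: (Lrho0 mu PM). Qed.

Let l0 : l (cst 0) = 0.
Proof.
have := l_lin 1 L0 L0.
rewrite (_ : (fun x => _) = cst 0); last by apply/funext => x /=; rewrite mulr0 addr0.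
by rewrite mul1r -[LHS]addr0 => /addrI/esym.
Qed.

Let lZ c u : Lrho u -> l (fun x => c * u x) = c * l u.
Proof.
move=> uL; have := l_lin c uL L0.
rewrite l0 addr0 => <-; congr l; apply/funext => x /=; by rewrite addr0.
Qed.

Let lD u v : Lrho u -> Lrho v -> l (fun x => u x + v x) = l u + l v.
Proof.
move=> uL vL; have := l_lin 1 uL vL; rewrite mul1r => <-; congr l.
by apply/funext => x; rewrite mul1r.
Qed.

Let lB u v : Lrho u -> Lrho v -> l (fun x => u x - v x) = l u - l v.
Proof.
move=> uL vL; have := l_lin (-1) vL uL; rewrite mulN1r addrC => <-; congr l.
by apply/funext => x; rewrite mulN1r addrC.
Qed.

(** The bound [l_bnd] at [m u], divided by m: the constant term shrinks to [A / m], at the price of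
    a factor [m^pM] on the modular. *)
Let l_le u m : Lrho u -> 1 <= m ->
  `|l u| <= A / m * (1 + m `^ pM * fine (rho u)).
Proof.
move=> uL m1; have m0 : 0 < m by rewrite (lt_le_trans ltr01).
have := l_bnd (LrhoZ mP PM m uL); rewrite lZ// normrM (gtr0_norm m0) => h.
rewrite mulrAC ler_pdivlMr// mulrC (le_trans h)// ler_wpM2l// lerD2l.
have rf : rho u \is a fin_num by rewrite ge0_fin_numE ?rho_ge0// uL.2.
have rf' : rho (fun x => m * u x) \is a fin_num.
  by rewrite ge0_fin_numE ?rho_ge0// (LrhoZ mP PM m uL).2.
rewrite -lee_fin EFinM !fineK//.
exact: (rhoZ_ge mu mP PM uL.1 m1).
Qed.

Lemma l_cvg0 (u_ : nat -> T -> R) : (forall k, Lrho (u_ k)) ->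
  rho (u_ k) @[k --> \oo] --> 0%E -> l (u_ k) @[k --> \oo] --> 0.
Proof.
move=> uL /fine_cvgP[_ u0]; apply/cvgr0Pnorm_lt => e e0.
(* Then [e m = e + 2 A], whence [2 A / m < e]; a modular below the inverse of [m^pM] keeps the
   bracket in [l_le] at most 2. *)
pose m := 1 + 2 * A / e.
have m1 : 1 <= m by rewrite lerDl divr_ge0 ?mulr_ge0// ltW.
have m0 : 0 < m by rewrite (lt_le_trans ltr01).
have mp : 0 < m `^ pM by rewrite powR_gt0.
have : \forall k \near \oo, `|fine (rho (u_ k))| < (m `^ pM)^-1.
  by apply: (@cvgr0_norm_lt _ _ _ _ _ (fun k => fine (rho (u_ k)))) => //; rewrite invr_gt0.
apply: filterS => k; rewrite ger0_norm ?fine_ge0 ?rho_ge0// => hk.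
apply: (le_lt_trans (l_le (uL k) m1)).
have : 1 + m `^ pM * fine (rho (u_ k)) <= 2.
  by rewrite mulr2n lerD2l// -(divff (lt0r_neq0 mp)) ler_wpM2l// ltW.
move=> h; apply: (@le_lt_trans _ _ (A / m * 2)).
  by rewrite ler_wpM2l// divr_ge0// ltW.
rewrite mulrAC ltr_pdivrMr//.
have -> : e * m = e + A * 2 by rewrite /m; field; rewrite gt_eqF.
by rewrite ltrDr.
Qed.

(** [|u_k - u| <= |2 v|], and [|2 v|^P] is integrable because [Lrho] is closed under scaling.
    Lebesgue's dominated convergence theorem thus gives convergence in modular, and [l_cvg0]
    concludes. *)
Lemma l_dominated (u_ : nat -> T -> R) u v : (forall k, measurable_fun setT (u_ k)) ->
  measurable_fun setT u -> Lrho v -> (forall k x, `|u_ k x| <= `|v x|) ->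
  (forall x, u_ k x @[k --> \oo] --> u x) -> l (u_ k) @[k --> \oo] --> l u.
Proof.
move=> mu_ mu' vL uv uc.
have uv' x : `|u x| <= `|v x|.
  rewrite -(cvg_lim _ (cvg_norm (uc x)))//; apply: limr_le.
    by apply: cvgP; exact: (cvg_norm (uc x)).
  by apply: nearW => k; exact: uv.
have uL : Lrho u by exact: le_Lrho vL uv'.
have u_L k : Lrho (u_ k) by exact: le_Lrho vL (uv k).
have dL k : Lrho (fun x => u_ k x - u x).
  rewrite (_ : (fun x => _) = (fun x => u_ k x + (-1) * u x)).
    exact: (LrhoD mP PM (u_L k) (LrhoZ mP PM (-1) uL)).
  by apply/funext => x; rewrite mulN1r.
apply/subr_cvg0; rewrite (_ : (fun k => _) = (fun k => l (fun x => u_ k x - u x))); last first.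
  by apply/funext => k; rewrite lB.
apply: l_cvg0 => //.
under eq_fun do rewrite rhoE.
have v2L : Lrho (fun x => 2 * v x) := LrhoZ mP PM 2 vL.
have := @dominated_cvg _ _ _ mu setT measurableT
  (fun k x => (`|u_ k x - u x| `^ P x)%:E) (cst 0%E) (fun x => (`|2 * v x| `^ P x)%:E).
rewrite integral0; apply => //.
- move=> k; apply: (measurable_rho mP); exact: (dL k).1.
- move=> x _; apply: cvg_EFin; first exact: nearW.
  apply: cvg_powR0 => //; first by case/andP: (PM x).
  have := (@subr_cvg0 _ _ _ _ _ (u_^~ x) (u x)).2 (uc x) => h.
  by apply/norm_cvg0P; exact: h.
- apply/integrableP; split; first exact: (measurable_rho mP v2L.1).
  rewrite (eq_integral (fun x => (`|2 * v x| `^ P x)%:E)) -?rhoE ?v2L.2//.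
  by move=> x _; rewrite gee0_abs// lee_fin powR_ge0.
- move=> k x _; rewrite gee0_abs ?lee_fin ?powR_ge0//.
  apply: ge0_ler_powR; rewrite ?nnegrE//.
    by case/andP: (PM x) => /(le_trans ler01).
  rewrite normrM (ger0_norm (ler0n _ 2)) mulr2n mulrDl mul1r.
  by rewrite (le_trans (ler_normB _ _))// lerD.
Qed.

Variable w : T -> R.
Hypothesis mw : measurable_fun setT w.
Hypothesis wL : Lrho w.

Definition l_charge (B : set T) : \bar R := (l (fun x => w x * \1_B x))%:E.

Let l_charge0 : l_charge set0 = 0%E.
Proof.
rewrite /l_charge (_ : (fun x => _) = cst 0) ?l0//.
by apply/funext => x; rewrite indic0 mulr0.
Qed.

Let l_charge_fin B : measurable B -> l_charge B \is a fin_num.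
Proof. by []. Qed.

Let l_chargeU B C : measurable B -> measurable C -> B `&` C = set0 ->
  l_charge (B `|` C) = (l_charge B + l_charge C)%E.
Proof.
move=> mB mC BC; rewrite /l_charge -EFinD -lD; [|exact: (Lrho_indic mP PM mB wL)|exact: (Lrho_indic mP PM mC wL)].
by congr (l _)%:E; apply/funext => x; rewrite indicU_disj//= mulrDr.
Qed.

(** Partial sums are values of l at [w 1_(B k)] for the finite unions [B k]. These functions are
    dominated by w and eventually constant at each point, so [l_dominated] applies. *)
Let l_charge_sigma_additive : semi_sigma_additive l_charge.
Proof.
move=> F mF tF mUF.
pose B k := \big[setU/set0]_(i < k) F i.
have mB k : measurable (B k) by exact: bigsetU_measurable.
have sumE k : (\sum_(0 <= i < k) l_charge (F i))%E = l_charge (B k).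
  elim: k => [|k IH]; first by rewrite big_geq// /B big_ord0 l_charge0.
  rewrite big_nat_recr//= IH /B big_ord_recr/= (l_chargeU (mB k) (mF k))//.
  rewrite /B -bigcup_mkord; apply/seteqP; split => // x [[i /= ik Fi] Fk].
  by move/trivIsetP : tF => /(_ i k Logic.I Logic.I); rewrite ltn_eqF// => /(_ isT)/seteqP[+ _] => /(_ x (conj Fi Fk)).
under eq_fun do rewrite sumE.
apply: cvg_EFin; first exact: nearW.
apply: (@l_dominated _ _ w) => //.
- by move=> k; apply: measurable_funM => //; exact: measurable_indic.
- by apply: measurable_funM => //; exact: measurable_indic.
- move=> k x; rewrite normrM ler_piMr// indicE; by case: (_ \in _); rewrite ?normr0 ?normr1.
- move=> x; apply: cvgM; first exact: cvg_cst.
  apply: cvg_near_cst.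
  have [[i _ Fix]|nF] := pselect ((\bigcup_i F i) x); last first.
    apply: nearW => k; rewrite !indicE !memNset// => /mem_set.
    by rewrite /B -bigcup_mkord inE => -[i _ Fi]; apply: nF; exists i.
  exists i.+1 => // k /= ik; rewrite !indicE !mem_set//; first by exists i.
  by rewrite /B -bigcup_mkord; exists i.
Qed.

HB.instance Definition _ := isCharge.Build _ _ _ l_charge
  l_charge0 l_charge_fin l_charge_sigma_additive.

Definition functional_charge : {charge set T -> \bar R} := l_charge.

Lemma l_charge_dominates : l_charge `<< mu.
Proof.
apply/null_content_dominatesP => B mB B0.
have BL : Lrho (fun x => w x * \1_B x) := Lrho_indic mP PM mB wL.
have r0 : rho (fun x => w x * \1_B x) = 0%E.
  rewrite rhoE; transitivity (\int[mu]_(x in B) (`|w x| `^ P x)%:E)%E; last first.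
    by apply: null_set_integral => //; apply: measurable_funTS; exact: (measurable_rho mP).
  rewrite [RHS]integral_mkcond; apply: eq_integral => x _.
  rewrite patchE indicE; case: ifPn => xB; first by rewrite mulr1.
  rewrite mulr0 normr0 powR0// gt_eqF//.
  by case/andP: (PM x) => /(lt_le_trans ltr01).
(* A constant sequence of modular 0 is mapped to a sequence tending to 0, so its constant value is
   0. *)
have : (fun=> l (fun x => w x * \1_B x)) @ \oo --> (0 : R).
  by apply: (l_cvg0 (fun=> BL)); rewrite r0; exact: cvg_cst.
by move=> /(cvg_unique (@Rhausdorff R) (cvg_cst _)) h; rewrite /l_charge h.
Qed.

End representation.

(** * The density represents the functional on the whole space *)

Section representation_density.
Import HBNNSimple.
Context d (T : measurableType d) (R : realType).
Variables (mu : {sigma_finite_measure set T -> \bar R}) (P : T -> R) (pM : R).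
Hypothesis mP : measurable_fun setT P.
Hypothesis PM : forall x, 1 <= P x <= pM.
Variables (l : (T -> R) -> R) (A : R).
Implicit Types (u v : T -> R) (c m : R).

Local Notation rho := (rho mu P).
Local Notation Lrho := (Lrho mu P).

Hypothesis l_lin : forall c u v, Lrho u -> Lrho v ->
  l (fun x => c * u x + v x) = c * l u + l v.
Hypothesis A_ge0 : 0 <= A.
Hypothesis l_bnd : forall u, Lrho u -> `|l u| <= A * (1 + fine (rho u)).
Variable w : T -> R.
Hypothesis mw : measurable_fun setT w.
Hypothesis w01 : forall x, 0 < w x <= 1.
Hypothesis wL : Lrho w.
Variable h : T -> R.
Hypothesis ih : mu.-integrable setT (EFin \o h).
Hypothesis hE : forall B, measurable B ->
  l (fun x => w x * \1_B x) = (\int[mu]_(x in B) h x)%R.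

Let w_gt0 x : 0 < w x. Proof. by case/andP: (w01 x). Qed.

Let mh : measurable_fun setT h.
Proof. by apply/measurable_EFinP; exact: measurable_int ih. Qed.

Let bnd (s : T -> R) := measurable_fun setT s /\ exists M : R, forall x, `|s x| <= M.

Let bnd_Lrho s : bnd s -> Lrho (fun x => w x * s x).
Proof.
move=> [ms [M sM]]; apply: (le_Lrho mP PM (v := fun x => M * w x)).
- exact: measurable_funM.
- exact: (LrhoZ mP PM).
- move=> x; rewrite !normrM mulrC ler_wpM2r// (le_trans (sM x))// ler_norm//.
Qed.

Let bnd_int s : bnd s -> mu.-integrable setT (EFin \o (fun x => s x * h x)).
Proof.
move=> [ms [M sM]]; apply: (@integrableMr _ _ _ mu setT measurableT s (EFin \o h)) => //.
exists M; split; first exact: num_real.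
by move=> y My x _ /=; rewrite (le_trans (sM x))// ltW.
Qed.

(** The defect of the representation at [w s]. It is linear in bounded s and vanishes on indicators,
    hence on simple functions. *)
Let D (s : T -> R) := l (fun x => w x * s x) - (\int[mu]_x (s x * h x))%R.

Let D_lin c s t : bnd s -> bnd t -> D (fun x => c * s x + t x) = c * D s + D t.
Proof.
move=> bs bt; rewrite /D.
have -> : (fun x => w x * (c * s x + t x)) = (fun x => c * (w x * s x) + w x * t x).
  by apply/funext => x; rewrite mulrDr mulrCA.
rewrite (l_lin c (bnd_Lrho bs) (bnd_Lrho bt)).
have -> : (\int[mu]_x ((c * s x + t x) * h x))%R =
    c * (\int[mu]_x (s x * h x))%R + (\int[mu]_x (t x * h x))%R.
  rewrite -RintegralZl//; last exact: bnd_int.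
  rewrite -RintegralD//; last exact: bnd_int.
    by apply: eq_Rintegral => x _; rewrite mulrDl mulrA.
  by apply: (@integrableZl _ _ _ mu setT measurableT c (EFin \o (fun x => s x * h x))); exact: bnd_int.
by rewrite mulrBr opprD addrACA.
Qed.

Let bnd_indic B : measurable B -> bnd \1_B.
Proof.
move=> mB; split; first exact: measurable_indic.
by exists 1 => x; rewrite indicE; case: (_ \in _); rewrite ?normr0 ?normr1.
Qed.

Let D_indic B : measurable B -> D \1_B = 0.
Proof.
move=> mB; rewrite /D hE// Rintegral_mkcond; apply/eqP; rewrite subr_eq0; apply/eqP.
apply: eq_Rintegral => x _; rewrite patchE indicE.
by case: (x \in B); rewrite ?mul1r ?mul0r.
Qed.

Let D_sum (r : seq R) (B : R -> set T) : (forall y, measurable (B y)) ->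
  let s := (fun x => \sum_(y <- r) y * \1_(B y) x) in bnd s /\ D s = 0.
Proof.
move=> mB; elim: r => [|c r [[mt [M tM]] Dt]] s.
  (* The empty sum is put in the form that [D_lin] treats, as a combination of indicators of the
     empty set. *)
  have s0 : s = (fun x => 1 * \1_set0 x + \1_set0 x).
    by apply/funext => x; rewrite /s big_nil indic0 mulr0 addr0.
  split; last by rewrite s0 D_lin ?D_indic// ?mulr0 ?addr0//; exact: bnd_indic.
  rewrite s0; split.
    by apply: measurable_funD; [apply: measurable_funM => //|]; exact: measurable_indic.
  by exists 0 => x; rewrite indic0 mulr0 addr0 normr0.
set t := (fun x => \sum_(y <- r) y * \1_(B y) x) in mt tM Dt.
have sE : s = (fun x => c * \1_(B c) x + t x).
  by apply/funext => x; rewrite /s big_cons.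
rewrite sE; split; last first.
  rewrite D_lin ?D_indic ?Dt ?mulr0 ?addr0//; first exact: bnd_indic.
  by split => //; exists M.
split.
  by apply: measurable_funD => //; apply: measurable_funM => //; exact: measurable_indic.
exists (`|c| + M) => x; rewrite (le_trans (ler_normD _ _))// //.
apply: lerD; last exact: tM.
by rewrite normrM ler_piMr// indicE; case: (_ \in _); rewrite ?normr0 ?normr1.
Qed.

(** The factor [1_B] is carried along so that the sets where h is nonnegative and negative can be
    tested separately. *)
Let D_nnsfun (s : {nnsfun T >-> R}) B : measurable B ->
  bnd (fun x => s x * \1_B x) /\ D (fun x => s x * \1_B x) = 0.
Proof.
move=> mB.
have -> : (fun x => s x * \1_B x) =
    (fun x => \sum_(y <- finmap.enum_fset (fset_set (range s))) y * \1_((s @^-1` [set y]) `&` B) x).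
  apply/funext => x; rewrite fimfunE fsbig_finite//= mulr_suml.
  by apply: eq_bigr => y _; rewrite indicI/= mulrA.
by apply: D_sum => y; exact: measurableI.
Qed.

Let int_nnsfun (s : {nnsfun T >-> R}) B : measurable B ->
  l (fun x => w x * (s x * \1_B x)) = (\int[mu]_x (s x * \1_B x * h x))%R.
Proof. by move=> mB; apply/eqP; rewrite -subr_eq0; apply/eqP; exact: (D_nnsfun s mB).2. Qed.

Let g x := h x / w x.

Let mg : measurable_fun setT g.
Proof. by apply: measurable_funM => //; apply: measurable_funV => // x; exact: ltW. Qed.

(** Write [u = w s], so that [u g = s h], and let simple functions increase to s. The functional
    side converges by domination by u, the integral side by domination by [|s h|]; integrability of
    [s h] is the point to establish. *)
Lemma representation_ge0 u : Lrho u -> (forall x, 0 <= u x) ->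
  mu.-integrable setT (EFin \o (fun x => u x * g x)) /\
  l u = (\int[mu]_x (u x * g x))%R.
Proof.
move=> uL u0; pose s x := u x / w x.
have s0 x : 0 <= s x by rewrite divr_ge0// ltW.
have ms : measurable_fun setT (EFin \o s).
  by apply/measurable_EFinP; apply: measurable_funM; [exact: uL.1|apply: measurable_funV => // x; exact: ltW].
pose s_ k := nnsfun_approx measurableT ms k.
have sc x : s_ k x @[k --> \oo] --> s x.
  have := @cvg_nnsfun_approx _ _ _ _ measurableT _ ms (fun x _ => s0 x) x Logic.I.
  by move/fine_cvgP => [].
have nds x : nondecreasing_seq (s_^~ x).
  by move=> i j ij; have /lefP := nd_nnsfun_approx measurableT ms ij; exact.
have s_s k x : s_ k x <= s x.
  rewrite -(cvg_lim _ (sc x))//; apply: nondecreasing_cvgn_le => //.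
  by apply: cvgP; exact: sc.
have ws_u k x : `|w x * s_ k x| <= `|u x|.
  have ws0 : 0 <= w x * s_ k x by rewrite mulr_ge0// ltW.
  rewrite (ger0_norm ws0) (ger0_norm (u0 x)).
  by rewrite mulrC -ler_pdivlMr// s_s.
have ws_L k : Lrho (fun x => w x * s_ k x).
  by apply: (le_Lrho mP PM _ uL) => //; apply: measurable_funM.
have sh_ge0 k x : 0 <= s_ k x * `|h x| by rewrite mulr_ge0.
have msk k : measurable_fun setT (s_ k) by exact: measurable_funP.
have indb B k x : measurable B -> `|w x * (s_ k x * \1_B x)| <= `|u x|.
  move=> _; rewrite (le_trans _ (ws_u k x))// mulrA normrM ler_piMr//.
  by rewrite indicE; case: (_ \in _); rewrite ?normr0 ?normr1.
have lbnd B k : measurable B ->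
    `|(\int[mu]_x (s_ k x * \1_B x * h x))%R| <= A * (1 + fine (rho u)).
  move=> mB; rewrite -int_nnsfun//.
  have L : Lrho (fun x => w x * (s_ k x * \1_B x)).
    apply: (le_Lrho mP PM _ uL); last by move=> x; exact: indb.
    by do 2 apply: measurable_funM => //; exact: measurable_indic.
  rewrite (le_trans (l_bnd L))// ler_wpM2l// lerD2l fine_le//.
  - by rewrite ge0_fin_numE ?rho_ge0// L.2.
  - by rewrite ge0_fin_numE ?rho_ge0// uL.2.
  - by apply: (le_rho mu mP PM L.1 uL.1) => x; exact: indb.
pose M := A * (1 + fine (rho u)) + A * (1 + fine (rho u)).
have intM k : (\int[mu]_x (s_ k x * `|h x|)%:E <= M%:E)%E.
  (* [|h|] is h on B and -h off B, so the integral is a difference of two quantities that [lbnd]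
     bounds independently of k. Monotone convergence then makes [s h] integrable. *)
  pose B := [set x | 0 <= h x].
  have mB : measurable B.
    rewrite (_ : B = h @^-1` `[0, +oo[%classic); last first.
      by apply/seteqP; split => x /=; rewrite in_itv/= andbT.
    by rewrite -[X in measurable X]setTI; exact: mh.
  have mBc : measurable (~` B) by exact: measurableC.
  have iB C : measurable C -> mu.-integrable setT (EFin \o (fun x => s_ k x * \1_C x * h x)).
    by move=> mC; apply: bnd_int; exact: (D_nnsfun (s_ k) mC).1.
  rewrite (_ : (\int[mu]_x _)%E = ((\int[mu]_x (s_ k x * \1_B x * h x))%R -
      (\int[mu]_x (s_ k x * \1_(~` B) x * h x))%R)%:E).
    rewrite lee_fin (le_trans (ler_norm _))// (le_trans (ler_normB _ _))// lerD//; exact: lbnd.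
  rewrite -RintegralB//; [|exact: iB..].
  rewrite /Rintegral fineK; last first.
    by apply: integrable_fin_num => //; exact: (integrableB measurableT (iB _ mB) (iB _ mBc)).
  apply: eq_integral => x _; congr EFin; rewrite !indicE in_setC.
  have [xB|xB] := boolP (x \in B); rewrite /= ?mulr1 ?mulr0 ?mul0r ?subr0 ?sub0r.
    by rewrite ger0_norm//; move: xB; rewrite inE.
  rewrite ler0_norm ?mulrN//; move/negP : xB; rewrite inE/= => /negP.
  by rewrite -ltNge => /ltW.
have sgE x : u x * g x = s x * h x.
  by rewrite /s /g mulrCA mulrC.
have ish : mu.-integrable setT (EFin \o (fun x => s x * h x)).
  apply/integrableP; split.
    apply/measurable_EFinP; apply: measurable_funM => //.
    exact/measurable_EFinP.
  rewrite (eq_integral (fun x => limn (fun k => (s_ k x * `|h x|)%:E))); last first.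
    move=> x _; apply/esym/cvg_lim => //=; rewrite normrM (ger0_norm (s0 x)).
    apply: cvg_EFin; first exact: nearW.
    by apply: cvgM; [exact: sc|exact: cvg_cst].
  rewrite monotone_convergence//.
  - apply: (@le_lt_trans _ _ M%:E); last exact: ltry.
    apply: lime_le; last by apply: nearW => k; exact: intM.
    apply: ereal_nondecreasing_is_cvgn => i j ij.
    apply: ge0_le_integral => //.
    + by move=> x _; rewrite lee_fin.
    + by apply/measurable_EFinP; apply: measurable_funM => //; exact: measurableT_comp.
    + by apply/measurable_EFinP; apply: measurable_funM => //; exact: measurableT_comp.
    + by move=> x _; rewrite lee_fin ler_wpM2r// nds.
  - by move=> k; apply/measurable_EFinP; apply: measurable_funM => //; exact: measurableT_comp.
  - by move=> k x _; rewrite lee_fin.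
  - by move=> x _ i j ij; rewrite lee_fin ler_wpM2r// nds.
split; first by apply: eq_integrable ish => // x _ /=; rewrite sgE.
have c1 : l (fun x => w x * s_ k x) @[k --> \oo] --> l u.
  apply: (l_dominated mP PM l_lin A_ge0 l_bnd (v := u)) => //.
  - by move=> k; exact: (ws_L k).1.
  - exact: uL.1.
  - move=> x; rewrite (_ : u x = w x * s x); last by rewrite /s mulrCA divff ?mulr1// gt_eqF.
    by apply: cvgM; [exact: cvg_cst|exact: sc].
have c2 : (\int[mu]_x (s_ k x * h x)%:E)%E @[k --> \oo] --> (\int[mu]_x (s x * h x)%:E)%E.
  apply: (@dominated_cvg _ _ _ mu setT measurableT _ _ (fun x => `|s x * h x|%:E)) => //.
  - by move=> k; apply/measurable_EFinP; exact: measurable_funM.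
  - move=> x _; apply: cvg_EFin; first exact: nearW.
    by apply: cvgM; [exact: sc|exact: cvg_cst].
  - exact: (integrable_norm ish).
  - move=> k x _; rewrite /= lee_fin normrM [leRHS]normrM ler_wpM2r//.
    by rewrite (ger0_norm (s0 x)) ger0_norm.
have c3 : l (fun x => w x * s_ k x) @[k --> \oo] --> (\int[mu]_x (s x * h x))%R.
  have /fine_cvgP[_] : (\int[mu]_x (s_ k x * h x)%:E)%E @[k --> \oo] -->
      ((\int[mu]_x (s x * h x))%R)%:E.
    by rewrite /Rintegral fineK//; exact: integrable_fin_num.
  apply: cvg_trans; apply: near_eq_cvg; apply: nearW => k /=.
  have := int_nnsfun (s_ k) measurableT.
  rewrite (_ : (fun x => w x * _) = (fun x => w x * s_ k x)); last first.
    by apply/funext => x; rewrite indicT mulr1.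
  move=> ->; rewrite /Rintegral; congr fine; apply: eq_integral => x _.
  by rewrite indicT mulr1.
rewrite (cvg_unique (@Rhausdorff R) c1 c3).
by apply: eq_Rintegral => x _; rewrite sgE.
Qed.

Lemma representation_Lrho u : Lrho u ->
  mu.-integrable setT (EFin \o (fun x => u x * g x)) /\
  l u = (\int[mu]_x (u x * g x))%R.
Proof.
move=> uL.
have pL : Lrho u^\+.
  apply: (le_Lrho mP PM _ uL); first by apply: measurable_funrpos; exact: uL.1.
  by move=> x; rewrite ger0_norm ?funrpos_ge0// /funrpos ge_max normr_ge0 ler_norm.
have nL : Lrho u^\-.
  apply: (le_Lrho mP PM _ uL); first by apply: measurable_funrneg; exact: uL.1.
  by move=> x; rewrite ger0_norm ?funrneg_ge0// /funrneg ge_max normr_ge0 andbT -normrN ler_norm.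
have [ip lp] := representation_ge0 pL (@funrpos_ge0 _ _ u).
have [in_ ln] := representation_ge0 nL (@funrneg_ge0 _ _ u).
have uE : u = (fun x => (-1) * u^\- x + u^\+ x).
  by apply/funext => x; rewrite mulN1r addrC -[in LHS](funrposBneg u).
have gE x : u x * g x = u^\+ x * g x - u^\- x * g x.
  by rewrite [in LHS]uE mulN1r addrC mulrBl.
split.
  have := integrableB measurableT ip in_; apply: eq_integrable => // x _ /=.
  by rewrite gE EFinB.
rewrite {1}uE (l_lin _ nL pL) lp ln mulN1r addrC -RintegralB//.
by apply: eq_Rintegral => x _; rewrite gE.
Qed.

End representation_density.

(** * The density belongs to the conjugate space *)

Section representation_conjugate.
Context d (T : measurableType d) (R : realType).
Variables (mu : {sigma_finite_measure set T -> \bar R}) (P : T -> R) (pM : R).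
Hypothesis mP : measurable_fun setT P.
Hypothesis PM : forall x, 1 <= P x <= pM.
Hypothesis P1 : forall x, 1 < P x.
Variables (l : (T -> R) -> R) (A : R).
Implicit Types (u v : T -> R) (c m : R).

Local Notation rho := (rho mu P).
Local Notation Lrho := (Lrho mu P).

Hypothesis l_lin : forall c u v, Lrho u -> Lrho v ->
  l (fun x => c * u x + v x) = c * l u + l v.
Hypothesis A_ge0 : 0 <= A.
Hypothesis l_bnd : forall u, Lrho u -> `|l u| <= A * (1 + fine (rho u)).

Let P_gt0 x : 0 < P x. Proof. exact: lt_trans (P1 x). Qed.
Let P1_gt0 x : 0 < P x - 1. Proof. by rewrite subr_gt0. Qed.

(* Testing the functional against [|s g|^(P' - 1) sgn g] cut off below [k w]
   gives [J <= s A (1 + J)] for the modular [J] of the test function. *)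
Lemma conjugate_modular_le1 (g w : T -> R) : measurable_fun setT g ->
  measurable_fun setT w -> (forall x, 0 < w x) -> Lrho w ->
  (forall u, Lrho u -> l u = (\int[mu]_x (u x * g x))%R) ->
  (\int[mu]_x (((2 * (A + 1))^-1 * `|g x|) `^ (P x / (P x - 1)))%:E <= 1)%E.
Proof.
move=> mg mw w0 wL lE; set s := (2 * (A + 1))^-1.
have A1 : 0 < A + 1 by rewrite ltr_wpDl.
have s_gt0 : 0 < s by rewrite invr_gt0 mulr_gt0.
(* With this, [J <= s A (1 + J)] gives [J <= (1 + J) / 2], that is [J <= 1]. *)
have sA : s * A <= 2^-1.
  by rewrite /s invfM -mulrA ler_piMr// ler_pdivrMl// mulr1 lerDl.
pose G x := s * `|g x|.
have G0 x : 0 <= G x by rewrite mulr_ge0// ltW.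
have mG : measurable_fun setT G.
  by apply: measurable_funM => //; exact: measurableT_comp.
have mP1 : measurable_fun setT (fun x => (P x - 1)^-1).
  by apply: measurable_funV; [exact: measurable_funB|move=> x; exact: ltW].
pose b x := G x `^ (P x - 1)^-1.
have mb : measurable_fun setT b by exact: measurable_powR_fun.
have b0 x : 0 <= b x by exact: powR_ge0.
pose e x : R := if 0 <= g x then 1 else -1.
have me : measurable_fun setT e.
  apply: measurable_fun_ifT => //; exact: measurable_fun_ler.
have eg x : e x * g x = `|g x|.
  rewrite /e; case: ifPn => [g0|]; first by rewrite mul1r ger0_norm.
  by rewrite -ltNge => g0; rewrite mulN1r ltr0_norm.
have e1 x : `|e x| = 1 by rewrite /e; case: ifP; rewrite ?normrN normr1.
(* Below [k w] the test function lies in [Lrho], so its modular is finite and can be absorbed. As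
   [w > 0], these sets increase to the whole space. *)
pose B k := [set x | b x <= k%:R * w x].
have mB k : measurable (B k).
  rewrite -[X in measurable X]setTI.
  have := @measurable_fun_ler _ _ _ setT b (fun x => k%:R * w x) mb (measurable_funM (measurable_cst _) mw).
  move=> /(_ measurableT [set true]) /(_ Logic.I) h.
  exact: h.
pose u k x := b x * e x * \1_(B k) x.
have mu_ k : measurable_fun setT (u k).
  by apply: measurable_funM; [exact: measurable_funM|exact: measurable_indic].
have uL k : Lrho (u k).
  apply: (le_Lrho mP PM (mu_ k) (LrhoZ mP PM k%:R wL)) => x.
  rewrite /u !normrM e1 mulr1 indicE; case: (boolP (x \in B k)); last first.
    by rewrite normr0 mulr0 mulr_ge0.
  by rewrite inE normr1 mulr1 (ger0_norm (b0 x)) normr_nat gtr0_norm.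
have bP x : b x `^ P x = G x `^ (P x / (P x - 1)).
  by rewrite /b -powRrM mulrC.
(* From [P / (P - 1) = 1 / (P - 1) + 1]: on [B k] the P-th power of b is b times [s |g|]. This turns
   the modular of the test function into s times the value of l at it. *)
have uE k x : `|u k x| `^ P x = s * (u k x * g x).
  rewrite /u !normrM e1 mulr1 indicE; case: (boolP (x \in B k)) => _; last first.
    by rewrite normr0 !mulr0 mul0r mulr0 powR0// gt_eqF.
  rewrite normr1 !mulr1 (ger0_norm (b0 x)) bP -mulrA eg mulrCA -/(G x).
  have -> : P x / (P x - 1) = (P x - 1)^-1 + 1.
    by field; rewrite gt_eqF.
  rewrite /b; have [->|Gx0] := eqVneq (G x) 0.
    by rewrite mulr0 powR0// gt_eqF// ltr_wpDl// invr_ge0 ltW.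
  by rewrite powRD ?Gx0 ?implybT// powRr1.
pose J k := fine (rho (u k)).
have rhoJ k : rho (u k) = (J k)%:E.
  by rewrite fineK// ge0_fin_numE ?rho_ge0// (uL k).2.
have J0 k : 0 <= J k by rewrite fine_ge0// rho_ge0.
have JE k : J k = s * l (u k).
  have ir : mu.-integrable setT (EFin \o (fun x => s * (u k x * g x))).
    apply/integrableP; split.
      by apply/measurable_EFinP; apply: measurable_funM => //; exact: measurable_funM.
    rewrite (eq_integral (fun x => (`|u k x| `^ P x)%:E)) -?rhoE ?(uL k).2//.
    by move=> x _ /=; rewrite -uE ger0_norm ?powR_ge0.
  have iug : mu.-integrable setT (EFin \o (fun x => u k x * g x)).
    have := integrableZl measurableT s^-1 ir; apply: eq_integrable => // x _ /=.
    by rewrite -EFinM mulKf ?gt_eqF.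
  rewrite lE// -RintegralZl// /J rhoE /Rintegral; congr fine.
  by apply: eq_integral => x _; rewrite uE.
have J1 k : J k <= 1.
  have : J k <= 2^-1 * (1 + J k).
    rewrite [leLHS]JE (@le_trans _ _ (s * (A * (1 + J k))))//.
      by rewrite ler_pM2l// (le_trans (ler_norm _))// l_bnd.
    by rewrite mulrA ler_wpM2r// addr_ge0.
  by move=> h; lra.
rewrite (eq_integral (fun x => limn (fun k => (`|u k x| `^ P x)%:E))); last first.
  move=> x _; apply/esym/cvg_lim => //.
  apply: cvg_EFin; first exact: nearW.
  (* Once k exceeds [b x / w x], the point x belongs to [B k] and the cut-off no longer acts
     there. *)
  apply: cvg_near_cst; exists (Num.truncn (b x / w x)).+1 => // k /= hk.
  have xB : x \in B k.
    rewrite inE /B /= -ler_pdivrMr// (le_trans (ltW (truncnS_gt _)))// ler_nat//.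
  by rewrite /u !normrM e1 mulr1 indicE xB normr1 mulr1 ger0_norm// bP.
rewrite monotone_convergence//.
- apply: lime_le; last first.
    by apply: nearW => k; rewrite -rhoE rhoJ lee_fin.
  apply: ereal_nondecreasing_is_cvgn => i j ij; rewrite -!rhoE.
  apply: (le_rho mu mP PM (mu_ i) (mu_ j)) => x.
  rewrite /u !normrM e1 mulr1 ler_wpM2l// !indicE.
  case: (boolP (x \in B i)) => //; rewrite ?normr0// inE => xi.
  rewrite mem_set// /B/= (le_trans xi)// ler_wpM2r ?ler_nat// ltW//.
- by move=> k; exact: (measurable_rho mP).
- move=> x _ i j ij; rewrite lee_fin ge0_ler_powR ?nnegrE ?normr_ge0//; first exact: ltW.
  rewrite /u !normrM e1 mulr1 ler_wpM2l// !indicE.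
  case: (boolP (x \in B i)) => //; rewrite ?normr0// inE => xi.
  rewrite mem_set// /B/= (le_trans xi)// ler_wpM2r ?ler_nat// ltW//.
Qed.

(** The modular is controlled for a multiple [s g] only, since [P / (P - 1)] may be unbounded when P
    is merely greater than 1; s disappears in [component_representation], where P stays away from
    1. *)
Theorem Lrho_dual : exists g : T -> R, [/\ measurable_fun setT g,
  exists2 s : R, 0 < s &
    (\int[mu]_x ((s * `|g x|) `^ (P x / (P x - 1)))%:E < +oo)%E,
  forall u, Lrho u -> mu.-integrable setT (EFin \o (fun x => u x * g x)) &
  forall u, Lrho u -> l u = (\int[mu]_x (u x * g x))%R].
Proof.
have [w [mw w01 woo]] := sigma_finite_weight mu.
have wL : Lrho w by exact: (le1_Lrho mP PM mw w01 woo).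
have w0 x : 0 < w x by case/andP: (w01 x).
pose nu : {charge set T -> \bar R} := functional_charge mP PM l_lin A_ge0 l_bnd mw wL.
have dom : nu `<< mu by exact: (l_charge_dominates mP PM l_lin A_ge0 l_bnd mw wL).
pose h0 := Radon_Nikodym nu mu.
have h0fin x : h0 x \is a fin_num by exact: Radon_Nikodym_fin_num.
pose h x := fine (h0 x).
have hh0 : EFin \o h = h0 by apply/funext => x /=; rewrite /h fineK.
have ih : mu.-integrable setT (EFin \o h).
  by rewrite hh0; exact: Radon_Nikodym_integrable.
have hE B : measurable B -> l (fun x => w x * \1_B x) = (\int[mu]_(x in B) h x)%R.
  move=> mB; have := Radon_Nikodym_integral dom mB => /(congr1 fine) /= ->.
  by rewrite /Rintegral; congr fine; apply: eq_integral => x _; rewrite -/(h0 x) -hh0.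
pose g x := h x / w x.
have rep u : Lrho u -> mu.-integrable setT (EFin \o (fun x => u x * g x)) /\
  l u = (\int[mu]_x (u x * g x))%R.
  exact: (representation_Lrho mP PM l_lin A_ge0 l_bnd mw w01 wL ih hE).
have mg : measurable_fun setT g.
  apply: measurable_funM; first by apply/measurable_EFinP; exact: measurable_int ih.
  by apply: measurable_funV => // x; exact: ltW.
exists g; split => //.
- exists (2 * (A + 1))^-1; first by rewrite invr_gt0 mulr_gt0// ltr_wpDl.
  apply: (@le_lt_trans _ _ 1%E); last exact: ltry.
  exact: (conjugate_modular_le1 mg mw w0 wL (fun u uL => (rep u uL).2)).
- by move=> u uL; exact: (rep u uL).1.
- by move=> u uL; exact: (rep u uL).2.
Qed.

End representation_conjugate.

(** * Complex-valued functions *)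

Section complex_modulus.
Context (R : realType).
Implicit Types (z : R[i]) (a : R).
Import ComplexField.

Lemma normcE_sqrt z : Normc.normc z = Num.sqrt (complex.Re z ^+ 2 + complex.Im z ^+ 2).
Proof. by case: z. Qed.

Lemma normc_ge0 z : 0 <= Normc.normc z.
Proof. by rewrite normcE_sqrt sqrtr_ge0. Qed.

Lemma sqr_normcE z : Normc.normc z ^+ 2 = complex.Re z ^+ 2 + complex.Im z ^+ 2.
Proof. by rewrite normcE_sqrt sqr_sqrtr// addr_ge0// sqr_ge0. Qed.

Lemma normr_Re_le z : `|complex.Re z| <= Normc.normc z.
Proof. by rewrite normcE_sqrt -sqrtr_sqr ler_sqrt ?addr_ge0 ?sqr_ge0// lerDl sqr_ge0. Qed.

Lemma normr_Im_le z : `|complex.Im z| <= Normc.normc z.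
Proof. by rewrite normcE_sqrt -sqrtr_sqr ler_sqrt ?addr_ge0 ?sqr_ge0// lerDr sqr_ge0. Qed.

Lemma normc_real a : Normc.normc (a%:C)%C = `|a|.
Proof. by rewrite normcE_sqrt /= expr0n addr0 sqrtr_sqr. Qed.

Lemma normc_le_ReIm z : Normc.normc z <= `|complex.Re z| + `|complex.Im z|.
Proof.
rewrite -(@ler_pXn2r _ 2)// ?nnegrE ?normc_ge0 ?addr_ge0//.
rewrite sqr_normcE sqrrD !real_normK ?num_real//.
by rewrite -addrA lerD2l lerDr mulrn_wge0// mulr_ge0.
Qed.

Lemma ReD z1 z2 : complex.Re (z1 + z2) = complex.Re z1 + complex.Re z2.
Proof. by case: z1 z2 => ? ? []. Qed.

Lemma ImD z1 z2 : complex.Im (z1 + z2) = complex.Im z1 + complex.Im z2.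
Proof. by case: z1 z2 => ? ? []. Qed.

Lemma ReM z1 z2 : complex.Re (z1 * z2) =
  complex.Re z1 * complex.Re z2 - complex.Im z1 * complex.Im z2.
Proof. by case: z1 z2 => ? ? []. Qed.

Lemma ImM z1 z2 : complex.Im (z1 * z2) =
  complex.Re z1 * complex.Im z2 + complex.Im z1 * complex.Re z2.
Proof. by case: z1 z2 => ? ? []. Qed.

(** The conjugate of [z / |z|]. At 0 the convention [0^-1 = 0] makes it 0, hence the modulus is at
    most 1 rather than equal to 1. *)
Definition phase z : R[i] :=
  Complex (complex.Re z / Normc.normc z) (- complex.Im z / Normc.normc z).

Lemma mul_phase z : z * phase z = ((Normc.normc z)%:C)%C.
Proof.
have [z0|z0] := eqVneq (Normc.normc z) 0.
  by rewrite z0 (Normc.eq0_normc z0) mul0r.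
apply/eqP; rewrite eq_complex ReM ImM /=; apply/andP; split; apply/eqP.
  rewrite mulNr mulrN opprK !mulrA -mulrDl -!expr2 -sqr_normcE expr2 mulfK//.
by rewrite mulNr mulrN mulrA [X in _ + X]mulrA [X in _ + X / _]mulrC addrC subrr.
Qed.

Lemma normc_phase z : Normc.normc (phase z) <= 1.
Proof.
have [z0|z0] := eqVneq (Normc.normc z) 0.
  by rewrite /phase z0 invr0 !mulr0 (_ : Complex 0 0 = 0)// Normc.normc0.
have := congr1 (@Normc.normc R) (mul_phase z).
rewrite Normc.normcM normc_real (ger0_norm (normc_ge0 _)) => h.
by rewrite -(ler_pM2l (_ : 0 < Normc.normc z)) ?h ?mulr1// lt0r z0 normc_ge0.
Qed.

End complex_modulus.

(** * Integration of complex-valued functions *)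

Section complex_integral.
Context (R : realType) (n : nat).
Local Notation mu := (lebesgue_Rn R n).
Implicit Types (f g h : Rn R n -> R[i]) (u : Rn R n -> R).

Lemma measurable_sqrt (D : set R) : measurable_fun D (@Num.sqrt R).
Proof. by apply: measurable_funTS; apply: continuous_measurable_fun; exact: sqrt_continuous. Qed.

Lemma measurable_normc f : cmeasurable f -> measurable_fun setT (fun x => Normc.normc (f x)).
Proof.
move=> [mr mi]; rewrite (_ : (fun x => _) =
    (@Num.sqrt R) \o (fun x => complex.Re (f x) ^+ 2 + complex.Im (f x) ^+ 2)).
  apply: measurableT_comp; first exact: measurable_sqrt.
  by apply: measurable_funD; exact: measurable_funX.
by apply/funext => x; rewrite normcE_sqrt.
Qed.

Lemma cmeasurableM f g : cmeasurable f -> cmeasurable g -> cmeasurable (fun x => f x * g x).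
Proof.
move=> [mfr mfi] [mgr mgi]; split.
  under eq_fun do rewrite ReM.
  by apply: measurable_funB; exact: measurable_funM.
under eq_fun do rewrite ImM.
by apply: measurable_funD; exact: measurable_funM.
Qed.

Lemma cmeasurableD f g : cmeasurable f -> cmeasurable g -> cmeasurable (fun x => f x + g x).
Proof.
move=> [mfr mfi] [mgr mgi]; split.
  under eq_fun do rewrite ReD.
  exact: measurable_funD.
under eq_fun do rewrite ImD.
exact: measurable_funD.
Qed.

Lemma cmeasurable_cst (z : R[i]) : cmeasurable (fun _ : Rn R n => z).
Proof. by split; exact: measurable_cst. Qed.

Lemma cmeasurable_real u : measurable_fun setT u -> cmeasurable (fun x => ((u x)%:C)%C).
Proof. by split => //=; exact: measurable_cst. Qed.

Lemma cmeasurable_phase f : cmeasurable f -> cmeasurable (fun x => phase (f x)).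
Proof.
move=> mf; have mV : measurable_fun setT (fun x => (Normc.normc (f x))^-1).
  by apply: measurable_funV; [exact: measurable_normc|move=> x; exact: normc_ge0].
case: mf => mr mi; split => /=; apply: measurable_funM => //.
by apply: measurableT_comp.
Qed.

Definition cintegrable f :=
  cmeasurable f /\ (\int[mu]_x (Normc.normc (f x))%:E < +oo)%E.

Lemma le_cintegrable f u : cmeasurable f -> measurable_fun setT u ->
  (forall x, Normc.normc (f x) <= u x) -> (\int[mu]_x (u x)%:E < +oo)%E -> cintegrable f.
Proof.
move=> mf mu' fu uoo; split => //; apply: le_lt_trans uoo.
apply: ge0_le_integral => //.
- by move=> x _; rewrite lee_fin normc_ge0.
- by apply/measurable_EFinP; exact: measurable_normc.
- exact/measurable_EFinP.
- by move=> x _; rewrite lee_fin.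
Qed.

Lemma cintegrable_norm f : cintegrable f ->
  mu.-integrable setT (EFin \o (fun x => Normc.normc (f x))).
Proof.
move=> [mf foo]; apply/integrableP; split.
  by apply/measurable_EFinP; exact: measurable_normc.
rewrite (eq_integral (fun x => (Normc.normc (f x))%:E))// => x _ /=.
by rewrite ger0_norm// normc_ge0.
Qed.

Lemma cintegrable_Re f : cintegrable f ->
  mu.-integrable setT (EFin \o (fun x => complex.Re (f x))).
Proof.
move=> fi; apply: le_integrable (cintegrable_norm fi) => //.
  by apply/measurable_EFinP; exact: fi.1.1.
by move=> x _ /=; rewrite lee_fin [leRHS]ger0_norm ?normc_ge0// normr_Re_le.
Qed.

Lemma cintegrable_Im f : cintegrable f ->
  mu.-integrable setT (EFin \o (fun x => complex.Im (f x))).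
Proof.
move=> fi; apply: le_integrable (cintegrable_norm fi) => //.
  by apply/measurable_EFinP; exact: fi.1.2.
by move=> x _ /=; rewrite lee_fin [leRHS]ger0_norm ?normc_ge0// normr_Im_le.
Qed.

Lemma cintegrable_lin (c : R[i]) f g : cintegrable f -> cintegrable g ->
  cintegrable (fun x => c * f x + g x).
Proof.
move=> fi gi.
have mcf : cmeasurable (fun x => c * f x + g x).
  apply: cmeasurableD gi.1; apply: cmeasurableM fi.1; exact: cmeasurable_cst.
apply: (le_cintegrable (u := fun x => Normc.normc c * Normc.normc (f x) + Normc.normc (g x))) => //.
- apply: measurable_funD; last exact: measurable_normc gi.1.
  by apply: measurable_funM => //; exact: measurable_normc fi.1.
- by move=> x; rewrite (le_trans (le_normcD _ _))// Normc.normcM.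
- have /integrableP[_] : mu.-integrable setT (EFin \o (fun x => Normc.normc c * Normc.normc (f x) + Normc.normc (g x))).
    exact: (integrableD measurableT (integrableZl measurableT (Normc.normc c) (cintegrable_norm fi)) (cintegrable_norm gi)).
  rewrite (eq_integral (fun x => (Normc.normc c * Normc.normc (f x) + Normc.normc (g x))%:E))// => x _ /=.
  by rewrite ger0_norm// addr_ge0// ?mulr_ge0// normc_ge0.
Qed.

Lemma cintegral_lin (c : R[i]) f g : cintegrable f -> cintegrable g ->
  cintegral (fun x => c * f x + g x) = c * cintegral f + cintegral g.
Proof.
move=> fi gi; apply/eqP; rewrite eq_complex ReD ImD ReM ImM /cintegral /=.
have iZ (a : R) u : mu.-integrable setT (EFin \o u) ->
    mu.-integrable setT (EFin \o (fun x => a * u x)).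
  move=> iu; exact: (integrableZl measurableT a iu).
have [fr fI] := (cintegrable_Re fi, cintegrable_Im fi).
have [gr gI] := (cintegrable_Re gi, cintegrable_Im gi).
apply/andP; split; apply/eqP.
  rewrite -!RintegralZl// -RintegralB//; [|exact: iZ..].
  rewrite -RintegralD//; last first.
    exact: (integrableB measurableT (iZ _ _ fr) (iZ _ _ fI)).
  by apply: eq_Rintegral => x _; rewrite ReD ReM.
rewrite -!RintegralZl// -RintegralD//; [|exact: iZ..].
rewrite -RintegralD//; last first.
  exact: (integrableD measurableT (iZ _ _ fI) (iZ _ _ fr)).
by apply: eq_Rintegral => x _; rewrite ImD ImM.
Qed.

(** [c f] is read as [(c - 1) f + f], a linear combination of the kind already treated. *)
Lemma cintegrableZ (c : R[i]) f : cintegrable f -> cintegrable (fun x => c * f x).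
Proof.
move=> fi; have := cintegrable_lin (c - 1) fi fi.
by under eq_fun do rewrite mulrBl mul1r subrK.
Qed.

Lemma cintegralZ (c : R[i]) f : cintegrable f ->
  cintegral (fun x => c * f x) = c * cintegral f.
Proof.
move=> fi; have := cintegral_lin (c - 1) fi fi.
rewrite mulrBl mul1r subrK => <-; congr cintegral.
by apply/funext => x; rewrite mulrBl mul1r subrK.
Qed.

Lemma cintegral_real u : cintegral (fun x => ((u x)%:C)%C) = (((\int[mu]_x u x)%R)%:C)%C.
Proof.
rewrite /cintegral /=; congr Complex.
by rewrite /Rintegral integral0.
Qed.

Lemma ae_eq_cintegral f g : cmeasurable f -> cmeasurable g ->
  {ae mu, forall x, f x = g x} -> cintegral f = cintegral g.
Proof.
move=> [mfr mfi] [mgr mgi] fg; rewrite /cintegral /Rintegral; congr (Complex (fine _) (fine _)).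
  apply: ae_eq_integral => //; [exact/measurable_EFinP|exact/measurable_EFinP|].
  by apply: filterS fg => x -> _.
apply: ae_eq_integral => //; [exact/measurable_EFinP|exact/measurable_EFinP|].
by apply: filterS fg => x -> _.
Qed.

(* Rotating by the phase of the integral makes the integral real, hence equal
   to the integral of the real part. *)
Lemma normc_cintegral_le f : cintegrable f ->
  ((Normc.normc (cintegral f))%:E <= \int[mu]_x (Normc.normc (f x))%:E)%E.
Proof.
move=> fi; set c := phase (cintegral f).
have ci := cintegrableZ c fi.
have h : cintegral (fun x => c * f x) = ((Normc.normc (cintegral f))%:C)%C.
  by rewrite cintegralZ// mulrC mul_phase.
have {}h : Normc.normc (cintegral f) = (\int[mu]_x complex.Re (c * f x)%R)%R.
  by have := congr1 (@complex.Re R) h.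
have -> : (\int[mu]_x (Normc.normc (f x))%:E)%E = ((\int[mu]_x Normc.normc (f x))%R)%:E.
  by rewrite /Rintegral fineK//; apply: integrable_fin_num => //; exact: cintegrable_norm.
rewrite lee_fin h; apply: le_Rintegral => //.
- exact: (cintegrable_Re ci).
- exact: (cintegrable_norm fi).
- move=> x _; rewrite (le_trans (ler_norm _))// (le_trans (normr_Re_le _))//.
  by rewrite Normc.normcM ler_piMl ?normc_ge0 ?normc_phase.
Qed.

End complex_integral.

(** * The mixed modular *)

Section mixed_modular.
Context d (T : measurableType d) (R : realType).
Variables (mu : {measure set T -> \bar R}) (P Q : T -> R) (pM qM : R).
Hypotheses (mP : measurable_fun setT P) (mQ : measurable_fun setT Q).
Hypothesis PM : forall x, 1 <= P x <= pM.
Hypothesis QM : forall x, 1 <= Q x <= qM.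
Implicit Types (u v : T -> R) (l m : R) (f g : nat -> T -> R).

Local Notation rho := (rho mu P).
Local Notation Lrho := (Lrho mu P).

Definition dilation l u : T -> R := fun x => l `^ (- (Q x)^-1) * u x.

(* The general term of [modular_lqLp] at [u = |f_nu|], with real exponents. *)
Definition lam u : \bar R :=
  ereal_inf [set l%:E | l in [set l : R | 0 < l /\ (rho (dilation l u) <= 1)%E]].

Definition mod_seq f : \bar R := (\sum_(nu <oo) lam (f nu))%E.

Let Q_gt0 x : 0 < Q x.
Proof. by case/andP: (QM x) => /(lt_le_trans ltr01). Qed.

Lemma measurable_dilation l u : measurable_fun setT u -> measurable_fun setT (dilation l u).
Proof.
move=> mu'; apply: measurable_funM => //; apply: measurable_powR_fun => //.
apply: measurableT_comp => //; apply: measurable_funV => // x; exact: ltW.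
Qed.

Lemma dilation_normM l u c x : `|dilation l (fun x => c * u x) x| = `|c| * `|dilation l u x|.
Proof. by rewrite /dilation mulrCA normrM. Qed.

Lemma le_dilation l l' u x : 0 < l -> l <= l' -> `|dilation l' u x| <= `|dilation l u x|.
Proof.
move=> l0 ll'; rewrite /dilation !normrM ler_wpM2r//.
have l'0 : 0 < l' by exact: lt_le_trans ll'.
rewrite !ger0_norm ?powR_ge0// !powRN lef_pV2 ?posrE ?powR_gt0//.
by rewrite ge0_ler_powR ?nnegrE ?invr_ge0 ?(ltW (Q_gt0 x)) ?(ltW l0) ?(ltW l'0).
Qed.

(** The powers of m combine to [m^(1/Q - 1)], at most 1 because [1 <= Q]. *)
Lemma dilation_div l m u x : 0 < l -> 1 <= m ->
  `|dilation (l / m) (fun x => m^-1 * u x) x| <= `|dilation l u x|.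
Proof.
move=> l0 m1; have m0 : 0 < m by rewrite (lt_le_trans ltr01).
have h : m^-1 * m^-1 `^ (- (Q x)^-1) <= 1.
  rewrite -(powR_inv1 (ltW m0)) -powRrM mulN1r opprK powR_inv1 ?(ltW m0)//.
  rewrite ler_pdivrMl// mulr1 ler1_powR// invf_le1//; by case/andP: (QM x).
rewrite dilation_normM /dilation powRM ?invr_ge0 ?(ltW m0) ?(ltW l0)//.
rewrite -normrM (_ : m^-1 * _ = m^-1 * m^-1 `^ (- (Q x)^-1) * (l `^ (- (Q x)^-1) * u x)); last by ring.
rewrite normrM ler_piMl// ger0_norm//.
by rewrite mulr_ge0 ?powR_ge0// invr_ge0 ltW.
Qed.

(** The powers of m combine to [m^(1 - qM/Q)], at most 1 because [Q <= qM]. *)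
Lemma dilation_mul l m u x : 0 < l -> 1 <= m ->
  `|dilation (m `^ qM * l) (fun x => m * u x) x| <= `|dilation l u x|.
Proof.
move=> l0 m1; have m0 : 0 < m by rewrite (lt_le_trans ltr01).
have h : m * (m `^ qM) `^ (- (Q x)^-1) <= 1.
  rewrite -powRrM mulrN powRN ler_pdivrMr ?powR_gt0// mul1r le1r_powR//.
  by rewrite ler_pdivlMr// mul1r; case/andP: (QM x).
rewrite dilation_normM /dilation powRM ?powR_ge0 ?(ltW l0)//.
rewrite -normrM (_ : m * _ = m * (m `^ qM) `^ (- (Q x)^-1) * (l `^ (- (Q x)^-1) * u x)); last by ring.
rewrite normrM ler_piMl// ger0_norm//.
by rewrite mulr_ge0 ?powR_ge0// ltW.
Qed.

Lemma lam_ge0 u : (0 <= lam u)%E.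
Proof. by apply: le_ereal_inf_tmp => _ [l [l0 _] <-]; rewrite lee_fin ltW. Qed.

Lemma lam_lbound l u : 0 < l -> (rho (dilation l u) <= 1)%E -> (lam u <= l%:E)%E.
Proof. by move=> l0 ul; apply: ereal_inf_lbound; exists l. Qed.

Lemma le_lam u v : measurable_fun setT u -> measurable_fun setT v ->
  (forall x, `|u x| <= `|v x|) -> (lam u <= lam v)%E.
Proof.
move=> mu' mv uv; apply: le_ereal_inf => _ [l [l0 vl] <-]; exists l => //; split => //.
apply: le_trans vl; apply: (le_rho mu mP PM); [exact: measurable_dilation..|].
by move=> x; rewrite /dilation !normrM ler_wpM2l.
Qed.

Lemma lam_div m u : measurable_fun setT u -> 1 <= m ->
  (lam (fun x => (m^-1 * u x)%R) <= m^-1%:E * lam u)%E.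
Proof.
move=> mu' m1; have m0 : 0 < m by rewrite (lt_le_trans ltr01).
rewrite lee_pdivlMl//; apply: le_ereal_inf_tmp => _ [l [l0 ul] <-].
rewrite -lee_pdivlMl// -EFinM mulrC; apply: lam_lbound; first exact: divr_gt0.
apply: le_trans ul; apply: (le_rho mu mP PM).
- by apply: measurable_dilation; exact: measurable_funM.
- exact: measurable_dilation.
- by move=> x; exact: dilation_div.
Qed.

Lemma lam_mul m u : measurable_fun setT u -> 1 <= m ->
  (lam (fun x => (m * u x)%R) <= (m `^ qM)%:E * lam u)%E.
Proof.
move=> mu' m1; have m0 : 0 < m by rewrite (lt_le_trans ltr01).
have mq0 : 0 < m `^ qM by exact: powR_gt0.
rewrite -lee_pdivrMl//; apply: le_ereal_inf_tmp => _ [l [l0 ul] <-].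
rewrite lee_pdivrMl// -EFinM; apply: lam_lbound; first exact: mulr_gt0.
apply: le_trans ul; apply: (le_rho mu mP PM).
- by apply: measurable_dilation; exact: measurable_funM.
- exact: measurable_dilation.
- by move=> x; exact: dilation_mul.
Qed.

Lemma lam_cst0 : lam (cst 0) = 0%E.
Proof.
apply/eqP; rewrite eq_le lam_ge0 andbT; apply/lee_addgt0Pr => e e0; rewrite add0e.
apply: lam_lbound => //; rewrite (_ : dilation _ _ = cst 0) ?rho0//.
  by rewrite (rho0 mu PM).
by apply/funext => x; rewrite /dilation mulr0.
Qed.

Lemma lam_le1 u : (rho u <= 1)%E -> (lam u <= 1)%E.
Proof.
move=> u1; apply: lam_lbound => //; rewrite (_ : dilation _ _ = u)//.
by apply/funext => x; rewrite /dilation powR1 mul1r.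
Qed.

(** Divided by [m = 1 + rho u], the function has modular at most 1, so the scaling parameter 1 is
    admissible; [lam_mul] undoes the division. *)
Lemma lam_fin u : Lrho u -> (lam u < +oo)%E.
Proof.
move=> uL; pose m := 1 + fine (rho u).
have ru0 : 0 <= fine (rho u) by rewrite fine_ge0 ?rho_ge0.
have m1 : 1 <= m by rewrite lerDl.
have m0 : 0 < m by rewrite (lt_le_trans ltr01).
have mu' : measurable_fun setT (fun x => m^-1 * u x) by apply: measurable_funM => //; exact: uL.1.
rewrite (_ : u = (fun x => m * (m^-1 * u x))); last first.
  by apply/funext => x; rewrite mulrA divff ?mul1r// gt_eqF.
apply: le_lt_trans (lam_mul mu' m1) _.
rewrite lte_mul_pinfty ?lee_fin ?powR_ge0//.
apply: (@le_lt_trans _ _ 1%E); last exact: ltry.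
apply: lam_le1; apply: le_trans (rhoZ_le mu mP PM uL.1 _) _.
  by rewrite invr_ge0 (ltW m0) invf_le1.
have -> : rho u = (fine (rho u))%:E.
  by rewrite fineK// ge0_fin_numE ?rho_ge0// uL.2.
by rewrite -EFinM lee_fin ler_pdivrMl// mulr1 lerDr.
Qed.

Lemma mod_seq_ge0 f : (0 <= mod_seq f)%E.
Proof. by apply: nneseries_ge0 => *; exact: lam_ge0. Qed.

Lemma le_mod_seq f g : (forall nu, measurable_fun setT (f nu)) ->
  (forall nu, measurable_fun setT (g nu)) ->
  (forall nu x, `|f nu x| <= `|g nu x|) -> (mod_seq f <= mod_seq g)%E.
Proof.
move=> mf mg fg; apply: lee_nneseries => [nu _ _|nu _]; first exact: lam_ge0.
exact: le_lam.
Qed.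

Lemma mod_seq_div m f : (forall nu, measurable_fun setT (f nu)) -> 1 <= m ->
  (mod_seq (fun nu x => (m^-1 * f nu x)%R) <= m^-1%:E * mod_seq f)%E.
Proof.
move=> mf m1; rewrite -nneseriesZl; last by move=> *; exact: lam_ge0.
by apply: lee_nneseries => [nu _ _|nu _]; [exact: lam_ge0|exact: lam_div].
Qed.

Lemma mod_seq_mul m f : (forall nu, measurable_fun setT (f nu)) -> 1 <= m ->
  (mod_seq (fun nu x => (m * f nu x)%R) <= (m `^ qM)%:E * mod_seq f)%E.
Proof.
move=> mf m1; rewrite -nneseriesZl; last by move=> *; exact: lam_ge0.
by apply: lee_nneseries => [nu _ _|nu _]; [exact: lam_ge0|exact: lam_mul].
Qed.

Lemma mod_seqZ_fin c f : (forall nu, measurable_fun setT (f nu)) ->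
  (mod_seq f < +oo)%E -> (mod_seq (fun nu x => (c * f nu x)%R) < +oo)%E.
Proof.
move=> mf foo; pose m := 1 + `|c|.
have m1 : 1 <= m by rewrite lerDl.
apply: (@le_lt_trans _ _ (mod_seq (fun nu x => m * f nu x))).
  apply: le_mod_seq => [nu|nu|nu x]; [exact: measurable_funM..|].
  by rewrite !normrM ler_wpM2r// (@ger0_norm _ m) ?lerDr// (le_trans ler01).
apply: le_lt_trans (mod_seq_mul mf m1) _.
by rewrite lte_mul_pinfty ?lee_fin ?powR_ge0.
Qed.

(** Near-optimal parameters, with slack [2^-(nu+1)] in the term of index nu and therefore 1 in
    total; no infimum has to be attained. *)
Lemma mod_seq_witness f : (mod_seq f < +oo)%E -> exists l : nat -> R,
  [/\ forall nu, 0 < l nu, forall nu, (rho (dilation (l nu) (f nu)) <= 1)%E &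
      (\sum_(nu <oo) (l nu)%:E <= mod_seq f + 1)%E].
Proof.
move=> foo.
have lfin nu : lam (f nu) \is a fin_num.
  rewrite ge0_fin_numE ?lam_ge0//; apply: le_lt_trans foo.
  apply: (@le_trans _ _ (\sum_(0 <= i < nu.+1) lam (f i))%E).
    by rewrite big_nat_recr//= leeDr// sume_ge0// => *; exact: lam_ge0.
  by apply: nneseries_lim_ge => *; exact: lam_ge0.
have /choice[l lP] nu : exists l : R, [/\ 0 < l, (rho (dilation l (f nu)) <= 1)%E &
    (l%:E <= lam (f nu) + (1 / (2 ^ nu.+1)%:R)%:E)%E].
  have e0 : 0 < 1 / (2 ^ nu.+1)%:R :> R by rewrite divr_gt0// ltr0n expn_gt0.
  have [_ [l [l0 ll] <-] lt] := lb_ereal_inf_adherent e0 (lfin nu).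
  by exists l; split => //; exact: ltW.
exists l; split; [by move=> nu; case: (lP nu)..|].
apply: le_trans (epsilon_trick xpredT (fun nu => lam_ge0 (f nu)) ler01).
apply: lee_nneseries => [nu _ _|nu _]; first by rewrite lee_fin; case: (lP nu) => /ltW.
by case: (lP nu).
Qed.

Lemma mod_seq_tail f : (mod_seq f < +oo)%E -> (forall nu, measurable_fun setT (f nu)) ->
  mod_seq (fun nu => if (nu < K)%N then cst 0 else f nu) @[K --> \oo] --> 0%E.
Proof.
move=> foo mf.
have /= := nneseries_tail_cvg foo (fun nu _ => lam_ge0 (f nu)).
apply: cvg_trans; apply: near_eq_cvg; apply: nearW => K.
rewrite /mod_seq eseries_cond eseries_mkcond; apply: eq_eseriesr => i _ /=.
by case: leqP => // _; rewrite lam_cst0.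
Qed.

Let P_gt0 x : 0 < P x.
Proof. by case/andP: (PM x) => /(lt_le_trans ltr01). Qed.

(* A countable family in the unit ball has, after damping its k-th member by
   4^-(k+1), a common majorant in the space: with [S] the sum of the damped
   modular densities, take [F = Lam^(1/Q) S^(1/P)]. *)
Lemma mod_seq_sup (f_ : nat -> nat -> T -> R) :
  (forall k nu, measurable_fun setT (f_ k nu)) ->
  (forall k, (mod_seq (f_ k) <= 1)%E) ->
  exists F : nat -> T -> R, [/\ forall nu, Lrho (F nu),
    forall nu x, 0 <= F nu x, (mod_seq F < +oo)%E &
    forall nu, {ae mu, forall x, forall k,
      (2 ^+ k.+1)^-1 * ((2 ^+ k.+1)^-1 * `|f_ k nu x|) <= F nu x}].
Proof.
move=> mf f1.
pose h k : R := (2 ^+ k.+1)^-1.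
have h0 k : 0 < h k by rewrite invr_gt0 exprn_gt0.
have h1 k : 1 <= 2 ^+ k.+1 :> R by rewrite exprn_ege1// ler1n.
have /choice[l lP] k : exists l : nat -> R, [/\ forall nu, 0 < l nu,
    forall nu, (rho (dilation (l nu) (f_ k nu)) <= 1)%E &
    (\sum_(nu <oo) (l nu)%:E <= 2%:E)%E].
  have [|l [l0 ll ls]] := @mod_seq_witness (f_ k).
    by rewrite (le_lt_trans (f1 k)) ?ltry.
  exists l; split => //; apply: le_trans ls _.
  by rewrite (_ : 2%:E = 1 + 1)%E ?leeD2r// -EFinD -[in RHS](natrD R 1 1).
(* One parameter serving all k at once: it dominates every [h k * l k nu], and its sum over nu is at
   most twice the sum of the [h k], that is 2. *)
pose Lam nu : \bar R := (\sum_(k <oo) (h k * l k nu)%:E)%E.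
have hl0 k nu : 0 < h k * l k nu by rewrite mulr_gt0//; case: (lP k).
have hl0e k nu : (0 <= (h k * l k nu)%:E)%E by rewrite lee_fin ltW.
have hlLam k nu : ((h k * l k nu)%:E <= Lam nu)%E.
  apply: (@le_trans _ _ (\sum_(0 <= i < k.+1) (h i * l i nu)%:E)%E).
    by rewrite big_nat_recr//= leeDr// sume_ge0.
  by apply: nneseries_lim_ge => *; exact: hl0e.
have LamE : (\sum_(nu <oo) Lam nu <= 2%:E)%E.
  rewrite nneseries_interchange//.
  apply: (@le_trans _ _ (\sum_(k <oo) (2%:E * (h k)%:E))%E).
    apply: lee_nneseries => [k _ _|k _]; first by apply: nneseries_ge0.
    under eq_eseriesr do rewrite EFinM.
    rewrite nneseriesZl; last by move=> nu _; rewrite lee_fin ltW//; case: (lP k).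
    by rewrite muleC lee_wpmul2r ?lee_fin ?(ltW (h0 k))//; case: (lP k).
  rewrite nneseriesZl; last by move=> k _; rewrite lee_fin ltW.
  by rewrite (nneseries_half R) mule1.
have Lam0 nu : (0 <= Lam nu)%E by apply: nneseries_ge0.
have Lamfin nu : Lam nu \is a fin_num.
  rewrite ge0_fin_numE//; apply: (@le_lt_trans _ _ 2%:E); last exact: ltry.
  apply: le_trans LamE.
  apply: (@le_trans _ _ (\sum_(0 <= i < nu.+1) Lam i)%E).
    by rewrite big_nat_recr//= leeDr// sume_ge0.
  by apply: nneseries_lim_ge => *; exact: Lam0.
pose L nu := fine (Lam nu).
have LE nu : (L nu)%:E = Lam nu by rewrite fineK.
have hlL k nu : h k * l k nu <= L nu by rewrite -lee_fin LE hlLam.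
have L0 nu : 0 < L nu by exact: lt_le_trans (hl0 0%N nu) (hlL 0%N nu).
(* The inner [h k] pays for passing from [l k nu] to [L nu >= h k * l k nu], by [dilation_div] with
   [m = 2^(k+1)]. The outer one brings the modular down to [h k], so that the sum over k has
   integral at most 1. *)
pose D k nu := dilation (L nu) (fun x => h k * (h k * f_ k nu x)).
have mD k nu : measurable_fun setT (D k nu).
  by apply: measurable_dilation; do 2 apply: measurable_funM => //.
have rhoD k nu : (rho (D k nu) <= (h k)%:E)%E.
  apply: (@le_trans _ _ (rho (fun x => h k * dilation (l k nu) (f_ k nu) x))).
    apply: (le_rho mu mP PM) => //.
      by apply: measurable_funM => //; exact: measurable_dilation.
    move=> x; rewrite /D dilation_normM [leRHS]normrM ler_wpM2l//.
    apply: (le_trans (le_dilation _ _ (hl0 k nu) (hlL k nu))).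
    by rewrite mulrC; apply: dilation_div => //; case: (lP k).
  have mdl : measurable_fun setT (dilation (l k nu) (f_ k nu)) by exact: measurable_dilation.
  apply: le_trans (rhoZ_le mu mP PM mdl _) _.
    by rewrite (ltW (h0 k)) /= /h invf_le1 ?exprn_gt0.
  by rewrite -[leRHS]mule1 lee_wpmul2l ?lee_fin ?(ltW (h0 k))//; case: (lP k).
pose S nu x : \bar R := (\sum_(k <oo) (`|D k nu x| `^ P x)%:E)%E.
have D0 k nu x : (0 <= (`|D k nu x| `^ P x)%:E)%E by rewrite lee_fin powR_ge0.
have S0 nu x : (0 <= S nu x)%E by apply: nneseries_ge0.
have mS nu : measurable_fun setT (S nu).
  by apply: ge0_emeasurable_sum => // k _; exact: (measurable_rho mP).
have intS nu : (\int[mu]_x S nu x <= 1)%E.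
  rewrite integral_nneseries//; last by move=> k; exact: (measurable_rho mP).
  rewrite -(nneseries_half R); apply: lee_nneseries => [k _ _|k _].
    exact: integral_ge0.
  by rewrite -rhoE.
pose s nu x := (fine (S nu x)) `^ (P x)^-1.
have s0 nu x : 0 <= s nu x by exact: powR_ge0.
have mVP : measurable_fun setT (fun x => (P x)^-1).
  by apply: measurable_funV => // x; exact: ltW.
have ms nu : measurable_fun setT (s nu).
  apply: measurable_powR_fun => //.
  exact: (measurableT_comp (fine_measurable measurableT) (mS nu)).
have rhos nu : (rho (s nu) <= 1)%E.
  apply: le_trans (intS nu); rewrite rhoE; apply: ge0_le_integral => //.
    exact: (measurable_rho mP).
  move=> x _; rewrite ger0_norm// -powRrM mulVf ?gt_eqF// powRr1 ?fine_ge0//.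
  by case: (S nu x) (S0 nu x) => [r| |]//= _; rewrite ?leey.
pose F nu x := L nu `^ (Q x)^-1 * s nu x.
have LQ nu x : L nu `^ (- (Q x)^-1) * L nu `^ (Q x)^-1 = 1.
  by rewrite powRN mulVf// gt_eqF// powR_gt0.
have dF nu : dilation (L nu) (F nu) = s nu.
  by apply/funext => x; rewrite /dilation /F mulrA LQ mul1r.
have F0 nu x : 0 <= F nu x by rewrite mulr_ge0// powR_ge0.
have mF nu : measurable_fun setT (F nu).
  apply: measurable_funM => //; apply: measurable_powR_fun => //.
  by apply: measurable_funV => // x; exact: ltW.
exists F; split => //.
- move=> nu; apply: (le_Lrho mP PM (v := fun x => (1 + L nu) * s nu x)) => //.
    apply: (LrhoZ mP PM); split => //.
    by apply: le_lt_trans (rhos nu) _; rewrite ltry.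
  move=> x; rewrite !ger0_norm// ?mulr_ge0// ?addr_ge0 ?(ltW (L0 nu))//.
  (* [L^(1/Q)] is at most L if [1 <= L], and at most 1 otherwise. *)
  rewrite ler_wpM2r//; have [L1|L1] := leP 1 (L nu).
    rewrite (@le_trans _ _ (L nu)) ?lerDr// ler1_powR// invf_le1//.
    by case/andP: (QM x).
  rewrite (@le_trans _ _ 1) ?lerDl ?(ltW (L0 nu))//.
  rewrite -[leRHS](@powRr0 _ (L nu)) ger_powR ?(L0 nu) ?(ltW L1)//.
  by rewrite invr_ge0 ltW.
- apply: (@le_lt_trans _ _ 2%:E); last exact: ltry.
  apply: le_trans LamE; apply: lee_nneseries => [nu _ _|nu _]; first exact: lam_ge0.
  by rewrite -LE; apply: lam_lbound => //; rewrite dF.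
- move=> nu.
  (* S may be infinite on a null set, where [fine] returns 0 and F is no majorant; integrability
     confines the failure to such a set. *)
  have iS : mu.-integrable setT (S nu).
    apply/integrableP; split => //; apply: (@le_lt_trans _ _ 1%E); last exact: ltry.
    by apply: le_trans (intS nu); under eq_integral do rewrite gee0_abs//.
  have := integrable_ae measurableT iS; apply: filterS => x /(_ Logic.I) Sfin k.
  have DS : `|D k nu x| `^ P x <= fine (S nu x).
    rewrite -lee_fin fineK//.
    apply: (@le_trans _ _ (\sum_(0 <= i < k.+1) (`|D i nu x| `^ P x)%:E)%E).
      by rewrite big_nat_recr//= leeDr// sume_ge0.
    by apply: nneseries_lim_ge => *; exact: D0.
  have Ds : `|D k nu x| <= s nu x.
    rewrite -[leLHS]powRr1// -(mulfV (lt0r_neq0 (P_gt0 x))) powRrM.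
    by rewrite ge0_ler_powR ?nnegrE ?powR_ge0 ?fine_ge0 ?invr_ge0 ?(ltW (P_gt0 x)).
  rewrite /F -ler_pdivrMl ?powR_gt0// -powRN.
  apply: le_trans Ds; rewrite /D /dilation !normrM ger0_norm ?powR_ge0//.
  by rewrite (gtr0_norm (h0 k)).
Qed.

End mixed_modular.

(** * Reduction to real exponents *)

Lemma rho_ae_eq d (T : measurableType d) (R : realType) (mu : {measure set T -> \bar R})
    (P u v : T -> R) : measurable_fun setT P ->
  measurable_fun setT u -> measurable_fun setT v ->
  {ae mu, forall x, u x = v x} -> rho mu P u = rho mu P v.
Proof.
move=> mP mu' mv uv; rewrite !rhoE; apply: ge0_ae_eq_integral => //.
- exact: measurable_rho.
- exact: measurable_rho.
- by apply: filterS uv => x -> _.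
Qed.

Section modular_of_exponent.
Context (R : realType) (n : nat).
Local Notation mu := (lebesgue_Rn R n).
Variables (p : Rn R n -> \bar R) (P : Rn R n -> R).
Hypotheses (mp : measurable_fun setT p) (mP : measurable_fun setT P).
Variable pM : R.
Hypothesis PM : forall x, 1 <= P x <= pM.
Hypothesis pP : {ae mu, forall x, p x = (P x)%:E}.
Implicit Types f : Rn R n -> R[i].

(** As p is finite almost everywhere, the set where it is infinite is null: the supremum term
    vanishes and the integral may run over the whole space. *)
Lemma modular_LpE f : cmeasurable f ->
  modular_Lp p f = rho mu P (fun x => Normc.normc (f x)).
Proof.
move=> mf; have mnf := measurable_normc mf.
have mD : measurable [set x | p x != +oo%E].
  by rewrite -[X in measurable X]setTI; exact: emeasurable_neq.
rewrite /modular_Lp [X in (_ + X)%E](_ : _ = 0%E) ?adde0; last first.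
  rewrite Lnorm.unlock; case: ifPn => // mu0.
  rewrite -[RHS](ess_sup_cst 0%E mu0); apply: eq_ess_sup.
  apply: filterS pP => x px /=; rewrite patchE memNset ?abse0//=.
  by rewrite px.
rewrite integral_mkcond rhoE; apply: ge0_ae_eq_integral => //.
- apply/(measurable_restrictT _ mD)/measurable_EFinP; apply: measurable_powR_fun => //.
    exact: measurable_funTS.
  apply: measurable_funTS; exact: (measurableT_comp (fine_measurable measurableT) mp).
- exact: measurable_rho.
- by move=> x _; rewrite patchE; case: ifP => // _; rewrite lee_fin powR_ge0.
- apply: filterS pP => x px _; rewrite patchE mem_set/=; last by rewrite px.
  by rewrite px ger0_norm ?normc_ge0.
Qed.

Lemma normcZr (c : R) (z : R[i]) : Normc.normc ((c%:C)%C * z) = `|c| * Normc.normc z.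
Proof. by rewrite Normc.normcM normc_real. Qed.

Lemma Lp_memP f :
  Lp_mem p f <-> cmeasurable f /\ Lrho mu P (fun x => Normc.normc (f x)).
Proof.
have lE (l : R) : rho mu P (fun x => Normc.normc ((l%:C)%C *: f x)) =
    rho mu P (fun x => l * Normc.normc (f x)).
  rewrite !rhoE; apply: eq_integral => x _.
  by rewrite normcZr !normrM normr_id.
split=> [[mf [l l0]]|[mf fL]].
  have mlf : cmeasurable (fun x => ((l^-1)%:C)%C * f x).
    by apply: cmeasurableM mf; exact: cmeasurable_cst.
  rewrite (modular_LpE mlf) => loo; split => //.
  rewrite (_ : (fun x => Normc.normc (f x)) =
    (fun x => l * (l^-1 * Normc.normc (f x)))); last first.
    by apply/funext => x; rewrite mulrA divff ?mul1r// gt_eqF.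
  apply: (LrhoZ mP PM); split.
    by apply: measurable_funM => //; exact: measurable_normc.
  by rewrite -lE.
split => //; exists 1 => //.
have m1f : cmeasurable (fun x => ((1^-1)%:C)%C * f x).
  by apply: cmeasurableM mf; exact: cmeasurable_cst.
rewrite (modular_LpE m1f) lE; apply: (LrhoZ mP PM _ fL).2.
Qed.

End modular_of_exponent.

Section mixed_space.
Context (R : realType) (n : nat).
Local Notation mu := (lebesgue_Rn R n).
Variables (p q : Rn R n -> \bar R) (P Q : Rn R n -> R).
Hypotheses (mp : measurable_fun setT p) (mP : measurable_fun setT P).
Hypotheses (mq : measurable_fun setT q) (mQ : measurable_fun setT Q).
Hypothesis q_ge1 : forall x, (1 <= q x)%E.
Variables pM qM : R.
Hypothesis PM : forall x, 1 <= P x <= pM.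
Hypothesis QM : forall x, 1 <= Q x <= qM.
Hypothesis pP : {ae mu, forall x, p x = (P x)%:E}.
Hypothesis qQ : {ae mu, forall x, q x = (Q x)%:E}.
Implicit Types (f g : fseq R n).

Local Notation nc f := (fun nu x => Normc.normc (f nu x)).
Local Notation modf f := (mod_seq mu P Q (nc f)).
Local Notation mem f := (@ns_mem _ (lqLp p q) f).
Local Notation norm f := (norm_lqLp p q f).

(** At [q x = +oo] both sides are 0: one by [+oo^-1 = 0], the other by [fine +oo = 0] and
    [0^-1 = 0]. *)
Let fine_inv_q x : fine (q x)^-1%E = (fine (q x))^-1.
Proof.
by case: (q x) (q_ge1 x) => [r| |]//= r1; rewrite ?inver ?invr0//;
  case: ifPn => // /eqP r0; move: r1; rewrite r0 lee_fin ler10.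
Qed.

Lemma lam_LpE (f : Rn R n -> R[i]) : cmeasurable f ->
  ereal_inf [set l%:E | l in [set l : R | 0 < l /\
    (modular_Lp p (fun x => ((l `^ (- fine (q x)^-1%E) * Normc.normc (f x))%:C)%C) <= 1)%E]] =
  lam mu P Q (fun x => Normc.normc (f x)).
Proof.
move=> mf; have mnf := measurable_normc mf; congr ereal_inf; congr image.
apply/funext => l; apply/propext.
have ml : measurable_fun setT (fun x => l `^ (- fine (q x)^-1%E) * Normc.normc (f x)).
  apply: measurable_funM => //; under eq_fun do rewrite fine_inv_q.
  apply: measurable_powR_fun => //; apply: measurableT_comp => //.
  apply: measurable_funV; first exact: (measurableT_comp (fine_measurable measurableT) mq).
  by move=> x; rewrite fine_ge0// (le_trans _ (q_ge1 x)).
have E : modular_Lp p (fun x => ((l `^ (- fine (q x)^-1%E) * Normc.normc (f x))%:C)%C) =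
    rho mu P (dilation Q l (fun x => Normc.normc (f x))).
  rewrite (modular_LpE mp mP pP (f := fun x => ((l `^ (- fine (q x)^-1%E) *
    Normc.normc (f x))%:C)%C) (cmeasurable_real ml)).
  apply: rho_ae_eq => //.
  - by apply: measurable_normc; exact: cmeasurable_real.
  - exact: (measurable_dilation mQ QM).
  - apply: filterS qQ => x qx.
    rewrite normc_real ger0_norm ?mulr_ge0 ?powR_ge0 ?normc_ge0//.
    by rewrite /dilation fine_inv_q qx.
by rewrite /mkset E.
Qed.

Lemma modular_lqLpE f : (forall nu, cmeasurable (f nu)) -> modular_lqLp p q f = modf f.
Proof. by move=> mf; apply: eq_eseriesr => nu _; exact: lam_LpE. Qed.

Lemma modular_lqLpZ (l : R) f : (forall nu, cmeasurable (f nu)) -> 0 <= l ->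
  modular_lqLp p q ((l%:C)%C *: f) = mod_seq mu P Q (fun nu x => l * Normc.normc (f nu x)).
Proof.
move=> mf l0; rewrite modular_lqLpE.
  congr mod_seq; apply/funext => nu; apply/funext => x.
  by rewrite -[X in X * _](ger0_norm l0) -normcZr.
by move=> nu; apply: cmeasurableM (mf nu); exact: cmeasurable_cst.
Qed.

(** The scale drops out as in [Lp_memP], here because [mod_seq] grows by at most [m^qM] under
    multiplication by m. *)
Lemma lqLp_memP f : mem f <->
  (forall nu, cmeasurable (f nu)) /\
  (forall nu, Lrho mu P (nc f nu)) /\ (modf f < +oo)%E.
Proof.
split=> [[fL [l l0]]|[mf [fL foo]]].
  have {}fL nu := (Lp_memP mp mP PM pP (f nu)).1 (fL nu).
  have mf nu := (fL nu).1.
  rewrite modular_lqLpZ ?invr_ge0 ?(ltW l0)// => loo.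
  split => //; split; first by move=> nu; exact: (fL nu).2.
  rewrite (_ : nc f = fun nu x => l * (l^-1 * Normc.normc (f nu x))); last first.
    by apply/funext => nu; apply/funext => x; rewrite mulrA divff ?mul1r// gt_eqF.
  apply: (mod_seqZ_fin mP mQ PM QM) => // nu.
  by apply: measurable_funM => //; exact: measurable_normc.
split; first by move=> nu; apply/(Lp_memP mp mP PM pP); split.
exists 1 => //; rewrite modular_lqLpZ ?invr_ge0//.
by apply: (mod_seqZ_fin mP mQ PM QM) => // nu; exact: measurable_normc.
Qed.

Let mnc f : (forall nu, cmeasurable (f nu)) -> forall nu, measurable_fun setT (nc f nu).
Proof. by move=> mf nu; exact: measurable_normc. Qed.

Lemma lqLp_mem_le f g : (forall nu, cmeasurable (f nu)) -> mem g ->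
  (forall nu x, Normc.normc (f nu x) <= Normc.normc (g nu x)) -> mem f.
Proof.
move=> mf /lqLp_memP[mg [gL goo]] fg; apply/lqLp_memP; split => //.
have fg' nu x : `|Normc.normc (f nu x)| <= `|Normc.normc (g nu x)|.
  by rewrite !ger0_norm ?normc_ge0.
split; first by move=> nu; apply: (le_Lrho mP PM _ (gL nu)) => //; exact: mnc.
apply: le_lt_trans goo; apply: (le_mod_seq mu mP mQ PM QM) => //; exact: mnc.
Qed.

Lemma norm_lqLp_le f g : (forall nu, cmeasurable (f nu)) -> (forall nu, cmeasurable (g nu)) ->
  (forall nu x, Normc.normc (f nu x) <= Normc.normc (g nu x)) -> (norm f <= norm g)%E.
Proof.
move=> mf mg fg; rewrite /norm_lqLp; apply: le_ereal_inf => _ [l [l0 lg] <-].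
exists l; last by []; split; first by [].
apply: le_trans lg; rewrite !modular_lqLpZ ?invr_ge0 ?(ltW l0)//.
apply: (le_mod_seq mu mP mQ PM QM) => [nu|nu|nu x].
- by apply: measurable_funM => //; exact: mnc.
- by apply: measurable_funM => //; exact: mnc.
- by rewrite !normrM ler_wpM2l// !ger0_norm ?normc_ge0.
Qed.

Lemma norm_lqLp_ge0 f : (0 <= norm f)%E.
Proof. by apply: le_ereal_inf_tmp => _ [l [l0 _] <-]; rewrite lee_fin ltW. Qed.

(** With [m = 1 + modf f], the modular of [f / m] is at most [modf f / m <= 1], so m is admissible
    in the infimum. *)
Lemma norm_lqLp_le_mod f : (forall nu, cmeasurable (f nu)) -> (modf f < +oo)%E ->
  (norm f <= 1 + modf f)%E.
Proof.
move=> mf foo; have fE : modf f = (fine (modf f))%:E by rewrite fineK// ge0_fin_numE ?mod_seq_ge0.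
have f0 : 0 <= fine (modf f) by rewrite fine_ge0 ?mod_seq_ge0.
pose m := 1 + fine (modf f).
have m1 : 1 <= m by rewrite lerDl.
have m0 : 0 < m by rewrite (lt_le_trans ltr01).
rewrite fE -EFinD -/m; apply: ereal_inf_lbound; exists m => //; split => //.
rewrite modular_lqLpZ ?invr_ge0 ?(ltW m0)//.
apply: le_trans (mod_seq_div mu mP mQ PM QM (mnc mf) m1) _.
by rewrite fE -EFinM lee_fin ler_pdivrMl// mulr1 lerDr.
Qed.

(** Strict inequality yields an admissible scale below l, whether or not the infimum is attained,
    and the modular decreases as the scale grows. *)
Lemma norm_lqLp_lt (l : R) f : (forall nu, cmeasurable (f nu)) -> (norm f < l%:E)%E ->
  0 < l /\ (mod_seq mu P Q (fun nu x => (l^-1 * Normc.normc (f nu x))%R) <= 1)%E.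
Proof.
move=> mf /ereal_inf_lt[_ [k [k0 fk] <-]]; rewrite lte_fin => kl.
have l0 := lt_trans k0 kl; split => //.
rewrite modular_lqLpZ ?invr_ge0 ?(ltW k0)// in fk.
apply: le_trans fk; apply: (le_mod_seq mu mP mQ PM QM) => [nu|nu|nu x].
- by apply: measurable_funM => //; exact: mnc.
- by apply: measurable_funM => //; exact: mnc.
- rewrite !normrM ler_wpM2r// !gtr0_norm ?invr_gt0// lef_pV2 ?posrE//; exact: ltW.
Qed.

End mixed_space.

(** * Complex series and conjugate exponents *)

Section complex_series.
Context (R : realType).
Implicit Types (u v : nat -> R[i]).
Import ComplexField.

Lemma is_cvg_series_le (a b : nat -> R) : (forall k, `|a k| <= b k) ->
  (\sum_(k <oo) (b k)%:E < +oo)%E -> cvgn (series a).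
Proof.
move=> ab boo; apply: normed_cvg; apply: (@series_le_cvg _ _ b) => //.
- by move=> k; exact: normr_ge0.
- by move=> k; exact: le_trans (ab k).
- by apply: nnseries_is_cvg => // k; exact: le_trans (ab k).
Qed.

Lemma Re_sum (s : seq nat) u : complex.Re (\sum_(k <- s) u k) = \sum_(k <- s) complex.Re (u k).
Proof. by apply: big_morph => // x y; exact: ReD. Qed.

Lemma Im_sum (s : seq nat) u : complex.Im (\sum_(k <- s) u k) = \sum_(k <- s) complex.Im (u k).
Proof. by apply: big_morph => // x y; exact: ImD. Qed.

Definition cabs_summable u := (\sum_(k <oo) (Normc.normc (u k))%:E < +oo)%E.

Lemma cvg_series_Re u : cabs_summable u -> cvgn (series (fun k => complex.Re (u k))).
Proof. by apply: is_cvg_series_le => k; exact: normr_Re_le. Qed.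

Lemma cvg_series_Im u : cabs_summable u -> cvgn (series (fun k => complex.Im (u k))).
Proof. by apply: is_cvg_series_le => k; exact: normr_Im_le. Qed.

Lemma cseries_sum_lin (c : R[i]) u v : cabs_summable u -> cabs_summable v ->
  cseries_sum (fun k => c * u k + v k) = c * cseries_sum u + cseries_sum v.
Proof.
move=> su sv.
have [ur ui] := (cvg_series_Re su, cvg_series_Im su).
have [vr vi] := (cvg_series_Re sv, cvg_series_Im sv).
apply/eqP; rewrite eq_complex ReD ImD ReM ImM /cseries_sum /=.
apply/andP; split; apply/eqP; apply: cvg_lim => //.
  rewrite (_ : series _ = (fun N => complex.Re c * series (fun k => complex.Re (u k)) N -
    complex.Im c * series (fun k => complex.Im (u k)) N + series (fun k => complex.Re (v k)) N)).
    by apply: cvgD => //; apply: cvgB; apply: cvgMl_tmp.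
  apply/funext => N; rewrite /series /= !mulr_sumr -sumrB -big_split/=.
  by apply: eq_bigr => k _; rewrite ReD ReM.
rewrite (_ : series _ = (fun N => complex.Re c * series (fun k => complex.Im (u k)) N +
  complex.Im c * series (fun k => complex.Re (u k)) N + series (fun k => complex.Im (v k)) N)).
  by apply: cvgD => //; apply: cvgD; apply: cvgMl_tmp.
apply/funext => N; rewrite /series /= !mulr_sumr -!big_split/=.
by apply: eq_bigr => k _; rewrite ImD ImM.
Qed.

(** [cseries_sum] takes the limits of real and imaginary parts separately; the modulus squeezes both
    errors. *)
Lemma cseries_sum_unique u (z : R[i]) :
  Normc.normc (\sum_(0 <= k < N) u k - z) @[N --> \oo] --> (0 : R) -> cseries_sum u = z.
Proof.
move=> h; apply/eqP; rewrite eq_complex /cseries_sum /=.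
have h0 : (fun=> 0 : R) @ \oo --> (0 : R) by exact: cvg_cst.
have h' : - Normc.normc (\sum_(0 <= k < N) u k - z) @[N --> \oo] --> (0 : R).
  by have := cvgN h; rewrite oppr0; exact.
apply/andP; split; apply/eqP; apply: cvg_lim => //; apply/subr_cvg0;
  apply: squeeze_cvgr h' h; apply: nearW => N; rewrite -ler_norml /series /=.
  apply: le_trans (normr_Re_le _); rewrite ReD Re_sum.
  by case: (z).
apply: le_trans (normr_Im_le _); rewrite ImD Im_sum.
by case: (z).
Qed.

Lemma cseries_sum_finite u N : (forall k, (N <= k)%N -> u k = 0) ->
  cseries_sum u = \sum_(0 <= k < N) u k.
Proof.
move=> u0; apply: cseries_sum_unique; apply: cvg_near_cst.
exists N => // M /= NM.
suff -> : \sum_(0 <= k < M) u k = \sum_(0 <= k < N) u k by rewrite subrr Normc.normc0.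
rewrite (big_cat_nat (leq0n N) NM)/= [X in _ + X]big_nat_cond.
by rewrite [X in _ + X]big1 ?addr0// => k /andP[/andP[Nk _] _]; exact: u0.
Qed.

(** As for integrals: after rotation by the phase of the sum, the modulus of the sum becomes a sum
    of real parts. *)
Lemma normc_cseries_sum_le u :
  ((Normc.normc (cseries_sum u))%:E <= \sum_(k <oo) (Normc.normc (u k))%:E)%E.
Proof.
have [su|] := ltP (\sum_(k <oo) (Normc.normc (u k))%:E)%E +oo%E; last first.
  by rewrite leye_eq => /eqP ->; rewrite leey.
set c := phase (cseries_sum u).
have s0 : cabs_summable (fun=> 0).
  by rewrite /cabs_summable eseries0// => *; rewrite Normc.normc0.
have nu0 k : (0 <= (Normc.normc (u k))%:E)%E by rewrite lee_fin normc_ge0.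
have scu : cabs_summable (fun k => c * u k).
  apply: le_lt_trans su; apply: lee_nneseries => [k _ _|k _].
    by rewrite lee_fin normc_ge0.
  by rewrite lee_fin Normc.normcM ler_piMl ?normc_ge0 ?normc_phase.
have h : cseries_sum (fun k => c * u k) = ((Normc.normc (cseries_sum u))%:C)%C.
  have := cseries_sum_lin c su s0; under eq_fun do rewrite addr0.
  have -> : cseries_sum (fun=> 0 : R[i]) = 0.
    by rewrite (@cseries_sum_finite (fun=> 0) 0)// big_geq.
  rewrite addr0 => ->.
  by rewrite mulrC mul_phase.
have {}h : Normc.normc (cseries_sum u) = limn (series (fun k => complex.Re (c * u k))).
  by have := congr1 (@complex.Re R) h.
have fin : (\sum_(k <oo) (Normc.normc (u k))%:E)%E \is a fin_num.
  by rewrite ge0_fin_numE// nneseries_ge0.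
rewrite -(fineK fin) lee_fin h; apply: limr_le; first exact: cvg_series_Re scu.
apply: nearW => N; rewrite -lee_fin fineK//.
apply: (@le_trans _ _ (\sum_(0 <= k < N) (Normc.normc (u k))%:E)%E); last first.
  by apply: nneseries_lim_ge => *; exact: nu0.
rewrite sumEFin lee_fin; apply: ler_sum => k _.
rewrite (le_trans (ler_norm _))// (le_trans (normr_Re_le _))//.
by rewrite Normc.normcM ler_piMl ?normc_ge0 ?normc_phase.
Qed.

End complex_series.

(** * Conjugate exponents and Young's inequality *)

Section conjugate_exponent.
Context (R : realType) (n : nat).
Local Notation mu := (lebesgue_Rn R n).
Variables (p : Rn R n -> \bar R) (P : Rn R n -> R).
Hypotheses (mp : measurable_fun setT p) (mP : measurable_fun setT P).
Hypothesis p_ge1 : forall x, (1 <= p x)%E.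
Variable pm : R.
Hypothesis pm1 : 1 < pm.
Hypothesis Pm : forall x, pm <= P x.
Hypothesis pP : {ae mu, forall x, p x = (P x)%:E}.

Definition conj_exp x := P x / (P x - 1).

Let P1 x : 0 < P x - 1.
Proof. by rewrite subr_gt0 (lt_le_trans pm1). Qed.

(** Since [P / (P - 1) = 1 + 1 / (P - 1)], a lower bound on P above 1 bounds the conjugate exponent,
    so the results on [Lrho] apply to it as well. *)
Lemma conj_exp_bounds x : 1 <= conj_exp x <= 1 + (pm - 1)^-1.
Proof.
have -> : conj_exp x = 1 + (P x - 1)^-1.
  by rewrite /conj_exp; field; rewrite gt_eqF.
rewrite lerDl invr_ge0 (ltW (P1 x)) lerD2l lef_pV2 ?posrE ?subr_gt0//=.
  by rewrite lerD2r.
exact: lt_le_trans (Pm x).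
Qed.

Lemma measurable_conj_exp : measurable_fun setT conj_exp.
Proof.
apply: measurable_funM => //; apply: measurable_funV.
  exact: measurable_funB.
by move=> x; exact: ltW.
Qed.

Lemma conjugate_exponent_ae : {ae mu, forall x, conjugate_exponent p x = (conj_exp x)%:E}.
Proof.
apply: filterS pP => x px; rewrite /conjugate_exponent px /hoelder_conjugate /=.
have P0 : P x != 0 by rewrite gt_eqF// (lt_le_trans _ (Pm x))// (lt_trans _ pm1).
by rewrite eqe (negbTE P0) -EFinB inver gt_eqF.
Qed.

Lemma measurable_conjugate_exponent : measurable_fun setT (conjugate_exponent p).
Proof.
(* The absolute value keeps the denominator nonnegative also where p is infinite and [fine] returns
   0, as [measurable_funV] requires. *)
rewrite (_ : conjugate_exponent p = fun x => if p x == +oo%E then 1%E else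
  if p x == 1%E then +oo%E else (fine (p x) / `|fine (p x) - 1|)%:E).
  have mfp : measurable_fun setT (fun x => fine (p x)).
    exact: (measurableT_comp (fine_measurable measurableT) mp).
  apply: measurable_fun_ifT => //; first exact: measurable_fun_eqe.
  apply: measurable_fun_ifT => //; first exact: measurable_fun_eqe.
  apply/measurable_EFinP; apply: measurable_funM => //.
  apply: measurable_funV => //; apply: measurableT_comp => //.
  exact: measurable_funB.
apply/funext => x; rewrite /conjugate_exponent /hoelder_conjugate.
case: (p x) (p_ge1 x) => [r| |]//; rewrite lee_fin => r1 /=.
have r0 : r != 0 by rewrite gt_eqF// (lt_le_trans _ r1).
rewrite eqe (negbTE r0) -EFinB inver subr_eq0 eqe; case: ifPn => [/eqP ->|r1'].
  by rewrite mul1e.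
by rewrite ger0_norm ?subr_ge0.
Qed.

(** Young's inequality with its factors [1/P] and [1/P'] bounded by 1. *)
Lemma young_conj_exp (a b : R) x : 0 <= a -> 0 <= b ->
  a * b <= a `^ P x + b `^ conj_exp x.
Proof.
move=> a0 b0.
have P0 : 0 < P x by rewrite (lt_le_trans _ (Pm x))// (lt_trans _ pm1).
have c1 : 1 <= conj_exp x by case/andP: (conj_exp_bounds x).
have c0 : 0 < conj_exp x by exact: lt_le_trans c1.
have pc : (P x)^-1 + (conj_exp x)^-1 = 1.
  by rewrite /conj_exp; field; rewrite !gt_eqF.
apply: le_trans (conjugate_powR a0 b0 P0 c0 pc) _.
rewrite lerD// ler_piMr ?powR_ge0// invf_le1//.
by rewrite (le_trans (ltW pm1)).
Qed.

Lemma cintegrable_pairing (f g : Rn R n -> R[i]) : cmeasurable f -> cmeasurable g ->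
  (rho mu P (fun x => Normc.normc (f x)) < +oo)%E ->
  (rho mu conj_exp (fun x => Normc.normc (g x)) < +oo)%E ->
  cintegrable (fun x => f x * g x).
Proof.
move=> mf mg foo goo.
have [mnf mng] := (measurable_normc mf, measurable_normc mg).
apply: (le_cintegrable (u := fun x => `|Normc.normc (f x)| `^ P x +
    `|Normc.normc (g x)| `^ conj_exp x)).
- exact: cmeasurableM.
- apply: measurable_funD; apply/measurable_EFinP; apply: measurable_rho => //.
  exact: measurable_conj_exp.
- move=> x; rewrite Normc.normcM !ger0_norm ?normc_ge0//.
  by apply: young_conj_exp; exact: normc_ge0.
- under eq_integral do rewrite EFinD.
  rewrite ge0_integralD//; [|exact: measurable_rho|
    by apply: measurable_rho => //; exact: measurable_conj_exp].
  by rewrite -!rhoE lte_add_pinfty.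
Qed.

End conjugate_exponent.

(** * The canonical map *)

Section koethe_duality.
Context (R : realType) (n : nat).
Local Notation mu := (lebesgue_Rn R n).
Variables (p q : Rn R n -> \bar R) (P Q : Rn R n -> R).
Hypotheses (mp : measurable_fun setT p) (mP : measurable_fun setT P).
Hypotheses (mq : measurable_fun setT q) (mQ : measurable_fun setT Q).
Hypothesis p_ge1 : forall x, (1 <= p x)%E.
Hypothesis q_ge1 : forall x, (1 <= q x)%E.
Variables pm pM qM : R.
Hypothesis pm1 : 1 < pm.
Hypothesis PmM : forall x, pm <= P x <= pM.
Hypothesis QM : forall x, 1 <= Q x <= qM.
Hypothesis pP : {ae mu, forall x, p x = (P x)%:E}.
Hypothesis qQ : {ae mu, forall x, q x = (Q x)%:E}.
Implicit Types (f g : fseq R n) (u h : Rn R n -> R[i]) (c : nat -> R[i]).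
Import ComplexField.

Local Notation nc f := (fun nu x => Normc.normc (f nu x)).
Local Notation modf f := (mod_seq mu P Q (nc f)).
Local Notation mem f := (@ns_mem _ (lqLp p q) f).
Local Notation norm f := (norm_lqLp p q f).
Local Notation P' := (conj_exp P).

Let PM x : 1 <= P x <= pM.
Proof. by have /andP[h ->] := PmM x; rewrite (le_trans (ltW pm1)). Qed.

Let Pm x : pm <= P x.
Proof. by case/andP: (PmM x). Qed.

Let P'M := conj_exp_bounds pm1 Pm.
Let mP' : measurable_fun setT P' := measurable_conj_exp mP pm1 Pm.

Let memP f : mem f <-> (forall nu, cmeasurable (f nu)) /\
  (forall nu, Lrho mu P (nc f nu)) /\ (modf f < +oo)%E.
Proof. exact: (lqLp_memP mp mP mq mQ q_ge1 PM QM pP qQ). Qed.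

Let mem_meas f : mem f -> forall nu, cmeasurable (f nu).
Proof. by case/memP. Qed.

Let mnc f : (forall nu, cmeasurable (f nu)) -> forall nu, measurable_fun setT (nc f nu).
Proof. by move=> mf nu; exact: measurable_normc. Qed.

(** The componentwise part of membership in the Koethe dual. It suffices for every single pairing to
    exist, and is what is available for a candidate g before its pairings are known to be
    summable. *)
Definition conj_mem g := forall nu, cmeasurable (g nu) /\ Lrho mu P' (nc g nu).

Lemma koethe_conj_mem g : @ns_mem _ (koethe_dual p q) g -> conj_mem g.
Proof.
move=> [gL _] nu.
by have /(Lp_memP (measurable_conjugate_exponent mp p_ge1) mP' P'M
  (conjugate_exponent_ae pm1 Pm pP)) := gL nu.
Qed.

Lemma pairing_integrable f g nu : mem f -> conj_mem g ->
  cintegrable (fun x => f nu x * g nu x).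
Proof.
move=> /memP[mf [fL _]] gc.
exact: (cintegrable_pairing mP pm1 Pm (mf nu) (gc nu).1 (fL nu).2 (gc nu).2.2).
Qed.

Definition fmul c f : fseq R n := fun nu x => c nu * f nu x.

Let fmul_meas c f : (forall nu, cmeasurable (f nu)) ->
  forall nu, cmeasurable (fmul c f nu).
Proof. by move=> mf nu; apply: cmeasurableM => //; exact: cmeasurable_cst. Qed.

Let fmul_le c f : (forall nu, Normc.normc (c nu) <= 1) ->
  forall nu x, Normc.normc (fmul c f nu x) <= Normc.normc (f nu x).
Proof. by move=> c1 nu x; rewrite Normc.normcM ler_piMl// normc_ge0. Qed.

Let fmul_mem c f : (forall nu, Normc.normc (c nu) <= 1) -> mem f -> mem (fmul c f).
Proof.
move=> c1 fm; have mf := mem_meas fm.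
apply: (lqLp_mem_le mp mP mq mQ q_ge1 PM QM pP qQ) fm _.
- exact: fmul_meas.
- exact: fmul_le.
Qed.

Let fmul_norm c f : (forall nu, Normc.normc (c nu) <= 1) -> mem f ->
  (norm (fmul c f) <= norm f)%E.
Proof.
move=> c1 /mem_meas fm; apply: (norm_lqLp_le mp mP mq mQ q_ge1 PM QM pP qQ) => //.
- exact: fmul_meas.
- exact: fmul_le.
Qed.

Let pairing_fmul c f g nu : mem f -> conj_mem g ->
  pairing (fmul c f) g nu = c nu * pairing f g nu.
Proof.
move=> fm gc; rewrite /pairing -cintegralZ; last exact: pairing_integrable.
by congr cintegral; apply/funext => x; rewrite mulrA.
Qed.

(* Scaling the first [N] terms by the phases of their pairings makes every
   pairing real and nonnegative. *)
Definition rotate f g N : fseq R n :=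
  fmul (fun nu => if (nu < N)%N then phase (pairing f g nu) else 0) f.

Let rotate1 f g N nu :
  Normc.normc (if (nu < N)%N then phase (pairing f g nu) else 0) <= 1.
Proof. by case: ifP => _; rewrite ?normc_phase ?Normc.normc0. Qed.

Lemma rotate_mem f g N : mem f -> mem (rotate f g N).
Proof. by apply: fmul_mem => nu; exact: rotate1. Qed.

Lemma rotate_norm f g N : mem f -> (norm (rotate f g N) <= norm f)%E.
Proof. by apply: fmul_norm => nu; exact: rotate1. Qed.

Lemma pairing_rotate f g N nu : mem f -> conj_mem g ->
  pairing (rotate f g N) g nu =
  if (nu < N)%N then ((Normc.normc (pairing f g nu))%:C)%C else 0.
Proof.
move=> fm gc; rewrite pairing_fmul//; case: ifP => _; last by rewrite mul0r.
by rewrite mulrC mul_phase.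
Qed.

(** The cut at N reduces the value to a finite sum, so summability of the pairings is not
    presupposed; [le_abs_pairing] passes to the limit. *)
Lemma canonical_map_rotate f g N : mem f -> conj_mem g ->
  canonical_map g (rotate f g N) =
  ((\sum_(0 <= nu < N) Normc.normc (pairing f g nu))%:C)%C.
Proof.
move=> fm gc; rewrite /canonical_map (@cseries_sum_finite _ _ N); last first.
  by move=> k Nk; rewrite pairing_rotate// ltnNge Nk.
rewrite rmorph_sum /= big_nat [RHS]big_nat; apply: eq_bigr => k /andP[_ kN].
by rewrite pairing_rotate// kN.
Qed.

Lemma le_abs_pairing f g (X : \bar R) :
  (forall N, ((\sum_(0 <= nu < N) Normc.normc (pairing f g nu))%:E <= X)%E) ->
  (abs_pairing f g <= X)%E.
Proof.
move=> h; rewrite /abs_pairing; apply: lime_le.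
  by apply: is_cvg_nneseries => *; rewrite lee_fin normc_ge0.
by apply: nearW => N; rewrite sumEFin.
Qed.

Lemma canonical_map_le f g :
  ((Normc.normc (canonical_map g f))%:E <= abs_pairing f g)%E.
Proof. exact: normc_cseries_sum_le. Qed.

Lemma koethe_norm_le g : conj_mem g ->
  (@ns_norm _ (koethe_dual p q) g <=
   @ns_norm _ (topological_dual (lqLp p q)) (canonical_map g))%E.
Proof.
move=> gc; apply: ge_ereal_sup => _ [f [fm f1] <-].
apply: le_abs_pairing => N; apply: ereal_sup_ubound.
exists (rotate f g N).
  split; first exact: rotate_mem.
  by apply: le_trans f1; exact: rotate_norm.
rewrite canonical_map_rotate// normc_real ger0_norm// sumr_ge0// => k _.
exact: normc_ge0.
Qed.

Lemma canonical_norm_le g :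
  (@ns_norm _ (topological_dual (lqLp p q)) (canonical_map g) <=
   @ns_norm _ (koethe_dual p q) g)%E.
Proof.
apply: ge_ereal_sup => _ [f [fm f1] <-].
apply: (le_trans (canonical_map_le f g)); apply: ereal_sup_ubound.
by exists f.
Qed.

Lemma norm_fin f : mem f -> norm f \is a fin_num.
Proof.
move=> /memP[mf [_ foo]]; rewrite ge0_fin_numE ?norm_lqLp_ge0//.
apply: le_lt_trans (norm_lqLp_le_mod mp mP mq mQ q_ge1 PM QM pP qQ mf foo) _.
by rewrite lte_add_pinfty// ltry.
Qed.

Let cscale_mem (a : R) f : mem f -> mem (((a%:C)%C : R[i]) *: f).
Proof.
move=> /memP[mf [fL foo]].
have ncE : nc (((a%:C)%C : R[i]) *: f) = fun nu x => `|a| * Normc.normc (f nu x).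
  by apply/funext => nu; apply/funext => x; rewrite -normcZr.
apply/memP; rewrite ncE; split.
  by move=> nu; apply: cmeasurableM (mf nu); exact: cmeasurable_cst.
split.
  move=> nu; rewrite (_ : (fun x => _) = fun x => `|a| * Normc.normc (f nu x)).
    exact: (LrhoZ mP PM _ (fL nu)).
  by apply/funext => x; rewrite -normcZr.
by apply: (mod_seqZ_fin mP mQ PM QM) => // nu; exact: measurable_normc.
Qed.

(* For every l > norm f the modular of f / l is at most 1. *)
Lemma bounded_of_modular (L : fseq R n -> R[i]) (M : R) : 0 < M ->
  (forall (a : R) f, mem f -> L (((a%:C)%C : R[i]) *: f) = (a%:C)%C * L f) ->
  (forall f, mem f -> (modf f <= 1)%E -> Normc.normc (L f) <= M) ->
  forall f, mem f -> ((Normc.normc (L f))%:E <= M%:E * norm f)%E.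
Proof.
move=> M0 LZ LM f fm; have mf := mem_meas fm.
rewrite -lee_pdivrMl//; apply/lee_addgt0Pr => e e0.
have lt : (norm f < (fine (norm f) + e)%:E)%E.
  by rewrite EFinD fineK ?norm_fin// lteDl ?norm_fin// lte_fin.
set l := fine (norm f) + e in lt.
have [l0 fl] := norm_lqLp_lt mp mP mq mQ q_ge1 PM QM pP qQ mf lt.
have := LM _ (cscale_mem l^-1 fm).
rewrite (_ : nc (((l^-1)%:C)%C *: f) = fun nu x => l^-1 * Normc.normc (f nu x)); last first.
  apply/funext => nu; apply/funext => x.
  by rewrite -[X in X * _](@ger0_norm _ l^-1) -?normcZr// invr_ge0 ltW.
move=> /(_ fl); rewrite LZ// normcZr gtr0_norm ?invr_gt0// ler_pdivrMl// => h.
by rewrite -EFinM -(fineK (norm_fin fm)) -EFinD lee_fin ler_pdivrMl// mulrC.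
Qed.

Let pairing_lin (a : R[i]) f1 f2 g : mem f1 -> mem f2 -> conj_mem g ->
  pairing (a *: f1 + f2) g = fun nu => a * pairing f1 g nu + pairing f2 g nu.
Proof.
move=> m1 m2 gc; apply/funext => nu; rewrite /pairing -cintegral_lin; [|exact: pairing_integrable..].
by congr cintegral; apply/funext => x; rewrite mulrA -mulrDl.
Qed.

Lemma canonical_map_lin g : @ns_mem _ (koethe_dual p q) g ->
  forall (a : R[i]) f1 f2, mem f1 -> mem f2 ->
  canonical_map g (a *: f1 + f2) = a * canonical_map g f1 + canonical_map g f2.
Proof.
move=> gk a f1 f2 m1 m2; have gc := koethe_conj_mem gk.
rewrite /canonical_map pairing_lin// cseries_sum_lin//.
- exact: gk.2.
- exact: gk.2.
Qed.

Lemma canonical_map_linl g1 g2 (a : R[i]) f : mem f ->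
  @ns_mem _ (koethe_dual p q) g1 -> @ns_mem _ (koethe_dual p q) g2 ->
  canonical_map (a *: g1 + g2) f = a * canonical_map g1 f + canonical_map g2 f.
Proof.
move=> fm gk1 gk2; have [gc1 gc2] := (koethe_conj_mem gk1, koethe_conj_mem gk2).
rewrite /canonical_map -cseries_sum_lin; [|exact: gk1.2|exact: gk2.2].
congr cseries_sum; apply/funext => nu.
rewrite /pairing -cintegral_lin; [|exact: pairing_integrable..].
congr cintegral; apply/funext => x.
rewrite (_ : (a *: g1 + g2) nu x = a * g1 nu x + g2 nu x)//.
by rewrite mulrDr mulrCA.
Qed.

Lemma koethe_bounded g : @ns_mem _ (koethe_dual p q) g -> exists2 M : R, 0 < M &
  forall f, mem f -> (modf f <= 1)%E -> (abs_pairing f g <= M%:E)%E.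
Proof.
move=> gk; have gc := koethe_conj_mem gk; apply: contrapT => nM.
have hk0 k : 0 < (2 ^+ k.+1)^-1 :> R by rewrite invr_gt0 exprn_gt0.
(* The k-th member will be damped by [4^-(k+1)] in [mod_seq_sup]; with this threshold its damped
   pairings still add up to more than [k + 1]. *)
have /choice[f_ fP] (k : nat) : exists f, [/\ mem f, (modf f <= 1)%E &
    ((k.+1%:R * (2 ^+ k.+1 * 2 ^+ k.+1))%:E < abs_pairing f g)%E].
  apply: contrapT => nf; apply: nM; exists (k.+1%:R * (2 ^+ k.+1 * 2 ^+ k.+1)).
    by rewrite !mulr_gt0// exprn_gt0.
  move=> f fm f1; rewrite leNgt; apply/negP => lt; apply: nf; exists f; split => //.
have mf k nu : cmeasurable (f_ k nu) by case: (fP k) => fm _ _; exact: mem_meas.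
have [F [FL F0 Foo Fge]] := mod_seq_sup mP mQ PM QM
  (f_ := fun k nu x => Normc.normc (f_ k nu x)) (fun k nu => measurable_normc (mf k nu))
  (fun k => let: And3 _ h _ := fP k in h).
have mF nu : measurable_fun setT (F nu) by exact: (FL nu).1.
pose G : fseq R n := fun nu x => ((F nu x)%:C)%C * phase (g nu x).
have mG nu : cmeasurable (G nu).
  apply: cmeasurableM; first exact: cmeasurable_real.
  exact: cmeasurable_phase (gc nu).1.
have GF nu x : `|Normc.normc (G nu x)| <= `|F nu x|.
  by rewrite ger0_norm ?normc_ge0// normcZr ler_piMr// normc_phase.
have Gm : mem G.
  apply/memP; split => //; split.
    by move=> nu; apply: (le_Lrho mP PM _ (FL nu)) => //; exact: measurable_normc.
  apply: le_lt_trans Foo; apply: (le_mod_seq mu mP mQ PM QM) => // nu.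
  exact: measurable_normc.
have GgE nu x : G nu x * g nu x = ((F nu x * Normc.normc (g nu x))%:C)%C.
  by rewrite /G -mulrA [phase _ * _]mulrC mul_phase rmorphM.
have mFg nu : measurable_fun setT (fun x => F nu x * Normc.normc (g nu x)).
  by apply: measurable_funM => //; exact: measurable_normc (gc nu).1.
have Fg0 nu x : 0 <= F nu x * Normc.normc (g nu x) by rewrite mulr_ge0// normc_ge0.
have pG nu : ((Normc.normc (pairing G g nu))%:E =
    \int[mu]_x (F nu x * Normc.normc (g nu x))%:E)%E.
  have iFg : mu.-integrable setT (EFin \o (fun x => F nu x * Normc.normc (g nu x))).
    have := cintegrable_norm (pairing_integrable nu Gm gc); apply: eq_integrable => // x _ /=.
    by rewrite GgE normc_real ger0_norm.
  rewrite /pairing; under eq_fun do rewrite GgE.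
  rewrite cintegral_real normc_real ger0_norm; last exact: Rintegral_ge0.
  by rewrite /Rintegral fineK//; exact: integrable_fin_num.
have Goo : (abs_pairing G g < +oo)%E by exact: gk.2.
have ge k : (k.+1%:R%:E <= abs_pairing G g)%E.
  have [fm _ fk] := fP k.
  set ck : R := (2 ^+ k.+1)^-1 * (2 ^+ k.+1)^-1.
  have ck0 : 0 < ck by rewrite mulr_gt0.
  apply: (@le_trans _ _ (ck%:E * abs_pairing (f_ k) g)%E).
    rewrite -lee_pdivrMl// -EFinM (le_trans _ (ltW fk))// lee_fin.
    by rewrite /ck invfM !invrK mulrC.
  rewrite /abs_pairing -nneseriesZl; last by move=> nu _; rewrite lee_fin normc_ge0.
  apply: lee_nneseries => [nu _ _|nu _].
    by rewrite -EFinM lee_fin mulr_ge0 ?normc_ge0// ltW.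
  rewrite pG.
  have ifg := pairing_integrable nu fm gc.
  have mnfg := measurable_normc ifg.1.
  apply: (@le_trans _ _ (ck%:E * \int[mu]_x (Normc.normc (f_ k nu x * g nu x))%:E)%E).
    by apply: lee_wpmul2l; [rewrite lee_fin ltW|exact: normc_cintegral_le].
  rewrite -ge0_integralZl_EFin//; first last.
  - exact: ltW.
  - exact/measurable_EFinP.
  - by move=> x _; rewrite lee_fin normc_ge0.
  apply: ae_ge0_le_integral => //.
  - by move=> x _; rewrite -EFinM lee_fin mulr_ge0 ?normc_ge0// ltW.
  - apply: measurable_funeM; exact/measurable_EFinP.
  - by move=> x _; rewrite lee_fin.
  - exact/measurable_EFinP.
  - apply: filterS (Fge nu) => x /(_ k); rewrite ger0_norm ?normc_ge0// => h _.
    rewrite -EFinM lee_fin Normc.normcM mulrA ler_wpM2r ?normc_ge0//.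
    by rewrite /ck -mulrA.
have Gfin : abs_pairing G g \is a fin_num.
  by rewrite ge0_fin_numE// nneseries_ge0// => *; rewrite lee_fin normc_ge0.
have := ge (Num.truncn (fine (abs_pairing G g))).
by rewrite -(fineK Gfin) lee_fin leNgt fineK// truncnS_gt.
Qed.

Lemma canonical_map_bounded g : @ns_mem _ (koethe_dual p q) g ->
  @ns_mem _ (topological_dual (lqLp p q)) (canonical_map g).
Proof.
move=> gk; split.
  by move=> a f1 f2 m1 m2; exact: canonical_map_lin.
have [M M0 gM] := koethe_bounded gk; exists M.
apply: bounded_of_modular => // [a f fm|f fm f1].
  have z0 : mem (0 : fseq R n) by rewrite -(scale0r f); exact: (cscale_mem 0 fm).
  have h0 : canonical_map g 0 = 0.
    have := canonical_map_lin gk 1 z0 z0; rewrite scaler0 addr0 mul1r => /eqP.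
    by rewrite -subr_eq0 opprD addrA subrr sub0r oppr_eq0 => /eqP.
  by have := canonical_map_lin gk (a%:C)%C fm z0; rewrite h0 !addr0.
by rewrite -lee_fin; apply: le_trans (canonical_map_le f g) (gM f fm f1).
Qed.

Definition single (nu0 : nat) u : fseq R n := fun nu => if nu == nu0 then u else 0.

Let nc_single nu0 u : nc (single nu0 u) =
  fun nu => if nu == nu0 then (fun x => Normc.normc (u x)) else cst 0.
Proof.
apply/funext => nu; apply/funext => x; rewrite /single.
by case: ifP => // _; rewrite Normc.normc0.
Qed.

Let mod_seq_single nu0 (v : Rn R n -> R) :
  mod_seq mu P Q (fun nu => if nu == nu0 then v else cst 0) = lam mu P Q v.
Proof.
apply: cvg_lim => //; apply: cvg_near_cst; exists nu0.+1 => // N /= nuN.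
rewrite (eq_bigr (fun nu => if nu == nu0 then lam mu P Q v else 0%E)).
  by rewrite -big_mkcond big_nat1_eq/= nuN.
by move=> nu _; case: ifP => // _; rewrite (lam_cst0 mu Q PM).
Qed.

Let single_meas nu0 u : cmeasurable u -> forall nu, cmeasurable (single nu0 u nu).
Proof.
by move=> mu' nu; rewrite /single; case: ifP => // _; exact: cmeasurable_cst.
Qed.

Lemma single_mem nu0 u : cmeasurable u -> Lrho mu P (fun x => Normc.normc (u x)) ->
  mem (single nu0 u).
Proof.
move=> mu' uL; apply/memP; split; first exact: single_meas.
split; last by rewrite nc_single mod_seq_single; exact: (lam_fin mP mQ PM QM).
move=> nu; have -> := congr1 (@^~ nu) (nc_single nu0 u) => /=.
by case: ifP => // _; exact: (Lrho0 mu PM).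
Qed.

(** Supplies, for a functional restricted to one component, the affine bound in the modular that
    [Lrho_dual] takes as hypothesis. *)
Lemma norm_single_le nu0 u : cmeasurable u -> Lrho mu P (fun x => Normc.normc (u x)) ->
  (norm (single nu0 u) <= 1 + rho mu P (fun x => Normc.normc (u x)))%E.
Proof.
move=> mu' uL; have mnu := uL.1.
set r := rho mu P _.
have r0 : (0 <= r)%E by exact: rho_ge0.
have rE : r = (fine r)%:E by rewrite fineK// ge0_fin_numE// uL.2.
have fr0 : 0 <= fine r by rewrite fine_ge0.
pose m := 1 + fine r.
have m1 : 1 <= m by rewrite lerDl.
have m0 : 0 < m by rewrite (lt_le_trans ltr01).
rewrite rE -EFinD -/m; apply: ereal_inf_lbound; exists m => //; split => //.
rewrite (modular_lqLpZ mp mP mq mQ q_ge1 QM pP qQ (single_meas nu0 mu'))//; last by rewrite invr_ge0 ltW.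
rewrite (_ : (fun nu x => _) = fun nu => if nu == nu0 then (fun x => m^-1 * Normc.normc (u x)) else cst 0).
  rewrite mod_seq_single; apply: lam_le1.
  apply: le_trans (rhoZ_le mu mP PM mnu _) _.
    by rewrite invr_ge0 (ltW m0) invf_le1.
  by rewrite -/r rE -EFinM lee_fin ler_pdivrMl// mulr1 lerDr.
apply/funext => nu; apply/funext => x.
have -> := congr1 (fun F => F nu x) (nc_single nu0 u) => /=.
by case: ifP => //= _; rewrite mulr0.
Qed.

Let pairing_single nu0 u g nu : pairing (single nu0 u) g nu =
  if nu == nu0 then cintegral (fun x => u x * g nu0 x) else 0.
Proof.
rewrite /pairing /single; case: eqP => [->//|_].
rewrite (_ : (fun x => _) = fun x => ((0 : R)%:C)%C).
  by rewrite cintegral_real Rintegral_cst//; rewrite mul0r.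
by apply/funext => x; rewrite mul0r.
Qed.

Lemma canonical_map_single nu0 u g :
  canonical_map g (single nu0 u) = cintegral (fun x => u x * g nu0 x).
Proof.
rewrite /canonical_map (@cseries_sum_finite _ _ nu0.+1); last first.
  by move=> k nk; rewrite pairing_single gtn_eqF.
rewrite (eq_bigr (fun nu => if nu == nu0 then cintegral (fun x => u x * g nu0 x) else 0)).
  by rewrite -big_mkcond big_nat1_eq/= ltnSn.
by move=> nu _; rewrite pairing_single.
Qed.

(** Testing one component against the weight w times the phase of [g1 - g2] shows that [w |g1 - g2|]
    has integral 0, and [w > 0]. *)
Lemma canonical_map_inj g1 g2 :
  @ns_mem _ (koethe_dual p q) g1 -> @ns_mem _ (koethe_dual p q) g2 ->
  (forall f, mem f -> canonical_map g1 f = canonical_map g2 f) ->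
  fseq_ae_eq g1 g2.
Proof.
move=> gk1 gk2 gE nu.
have [gc1 gc2] := (koethe_conj_mem gk1, koethe_conj_mem gk2).
have [w [mw w01 woo]] := sigma_finite_weight mu.
have wL : Lrho mu P w by exact: (le1_Lrho mP PM mw w01 woo).
have w0 x : 0 < w x by case/andP: (w01 x).
pose h x := g1 nu x + -1 * g2 nu x.
have mh : cmeasurable h.
  apply: cmeasurableD; first exact: (gc1 nu).1.
  by apply: cmeasurableM; [exact: cmeasurable_cst|exact: (gc2 nu).1].
pose u x := ((w x)%:C)%C * phase (h x).
have mu' : cmeasurable u.
  by apply: cmeasurableM; [exact: cmeasurable_real|exact: cmeasurable_phase].
have uL : Lrho mu P (fun x => Normc.normc (u x)).
  apply: (le_Lrho mP PM _ wL); first exact: measurable_normc.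
  by move=> x; rewrite ger0_norm ?normc_ge0// normcZr ler_piMr// normc_phase.
have sm := single_mem nu mu' uL.
have i1 : cintegrable (fun x => u x * g1 nu x).
  exact: (cintegrable_pairing mP pm1 Pm mu' (gc1 nu).1 uL.2 (gc1 nu).2.2).
have i2 : cintegrable (fun x => u x * g2 nu x).
  exact: (cintegrable_pairing mP pm1 Pm mu' (gc2 nu).1 uL.2 (gc2 nu).2.2).
have uhE x : -1 * (u x * g2 nu x) + u x * g1 nu x = ((w x * Normc.normc (h x))%:C)%C.
  rewrite (_ : _ + _ = u x * h x); last by rewrite /h; ring.
  by rewrite /u -mulrA [phase _ * _]mulrC mul_phase rmorphM.
have : cintegral (fun x => -1 * (u x * g2 nu x) + u x * g1 nu x) = 0.
  by rewrite cintegral_lin// -!canonical_map_single gE// mulN1r addrC subrr.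
have iwh := cintegrable_norm (cintegrable_lin (-1) i2 i1).
under eq_fun do rewrite uhE.
rewrite cintegral_real => /(congr1 (@complex.Re R)) /= int0.
have mwh : measurable_fun setT (fun x => w x * Normc.normc (h x)).
  by apply: measurable_funM => //; exact: measurable_normc.
have wh0 x : 0 <= w x * Normc.normc (h x) by rewrite mulr_ge0 ?normc_ge0// ltW.
have {}int0 : (\int[mu]_x `|(w x * Normc.normc (h x))%:E| = 0)%E.
  have iwh' : mu.-integrable setT (EFin \o (fun x => w x * Normc.normc (h x))).
    by move: iwh; apply: eq_integrable => // x _ /=; rewrite uhE normc_real ger0_norm.
  under eq_integral do rewrite gee0_abs ?lee_fin//.
  by rewrite -[LHS]fineK ?(integrable_fin_num _ iwh')//; congr EFin.
have := (ae_eq_integral_abs mu measurableT ((measurable_EFinP _ _).2 mwh)).1 int0.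
apply: filterS => x /(_ Logic.I) /= [/eqP]; rewrite mulf_eq0 gt_eqF//= => /eqP.
by move/Normc.eq0_normc => /eqP; rewrite /h mulN1r subr_eq0 => /eqP.
Qed.

(** * Every bounded functional is given by a sequence of densities *)

Section surjectivity.
Variable L : fseq R n -> R[i].
Hypothesis L_lin : forall (a : R[i]) f1 f2, mem f1 -> mem f2 ->
  L (a *: f1 + f2) = a * L f1 + L f2.
Variable C : R.
Hypothesis C0 : 0 <= C.
Hypothesis L_bnd : forall f, mem f -> ((Normc.normc (L f))%:E <= C%:E * norm f)%E.

Let mem0 : mem (0 : fseq R n).
Proof.
have := single_mem 0 (@cmeasurable_cst R n 0).
have z : (fun x : Rn R n => Normc.normc (0 : R[i])) = cst 0.
  by apply/funext => x; rewrite Normc.normc0.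
rewrite z => /(_ (Lrho0 mu PM)).
by rewrite (_ : single 0 _ = 0)//; apply/funext => nu; rewrite /single; case: ifP.
Qed.

Let L0 : L 0 = 0.
Proof.
have := L_lin 1 mem0 mem0; rewrite scaler0 addr0 mul1r => /eqP.
by rewrite -subr_eq0 opprD addrA subrr sub0r oppr_eq0 => /eqP.
Qed.

Let LZ (a : R[i]) f : mem f -> L (a *: f) = a * L f.
Proof. by move=> fm; have := L_lin a fm mem0; rewrite L0 !addr0. Qed.

Let LD f1 f2 : mem f1 -> mem f2 -> L (f1 + f2) = L f1 + L f2.
Proof. by move=> m1 m2; have := L_lin 1 m1 m2; rewrite scale1r mul1r. Qed.

Let L_mod f : mem f -> ((Normc.normc (L f))%:E <= C%:E * (1 + modf f))%E.
Proof.
move=> fm; have [mf [_ foo]] := (memP f).1 fm.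
apply: le_trans (L_bnd fm) _; apply: lee_wpmul2l; first by rewrite lee_fin.
exact: (norm_lqLp_le_mod mp mP mq mQ q_ge1 PM QM pP qQ mf foo).
Qed.

Let rsingle nu0 (v : Rn R n -> R) := single nu0 (fun x => ((v x)%:C)%C).

Let rsingle_L v : Lrho mu P v -> Lrho mu P (fun x => Normc.normc ((v x)%:C)%C).
Proof.
move=> vL; under eq_fun do rewrite normc_real.
exact: (Lrho_norm mP PM).
Qed.

Let rsingle_mem nu0 v : Lrho mu P v -> mem (rsingle nu0 v).
Proof.
move=> vL; apply: single_mem; last exact: rsingle_L.
by apply: cmeasurable_real; exact: vL.1.
Qed.

Let rsingle_lin nu0 (a : R) v1 v2 : Lrho mu P v1 -> Lrho mu P v2 ->
  L (rsingle nu0 (fun x => a * v1 x + v2 x)) =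
  (a%:C)%C * L (rsingle nu0 v1) + L (rsingle nu0 v2).
Proof.
move=> L1 L2; rewrite -L_lin; [|exact: rsingle_mem..]; congr L.
apply/funext => nu; apply/funext => x; rewrite /rsingle /single.
rewrite (_ : (_ + _) nu x = (a%:C)%C * (if nu == nu0 then (fun x => ((v1 x)%:C)%C) else 0) x +
  (if nu == nu0 then (fun x => ((v2 x)%:C)%C) else 0) x)//.
by case: ifP => _ /=; rewrite ?rmorphD ?rmorphM// mulr0 addr0.
Qed.

Let rsingle_bnd nu0 v : Lrho mu P v ->
  Normc.normc (L (rsingle nu0 v)) <= C * (1 + fine (rho mu P v)).
Proof.
move=> vL; have mv := vL.1.
have rE : rho mu P (fun x => Normc.normc ((v x)%:C)%C) = rho mu P v.
  by rewrite !rhoE; apply: eq_integral => x _; rewrite normc_real normr_id.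
rewrite -lee_fin EFinM EFinD fineK; last by rewrite ge0_fin_numE ?rho_ge0// vL.2.
apply: le_trans (L_bnd (rsingle_mem nu0 vL)) _.
apply: lee_wpmul2l; first by rewrite lee_fin.
rewrite -rE; apply: norm_single_le; last exact: rsingle_L.
exact: cmeasurable_real.
Qed.

(** [Lrho_dual] concerns real functionals, so it is used for the real and the imaginary part of L on
    real-valued functions. The densities a and b give [h = a + i b], and complex linearity extends
    the formula to [u = u1 + i u2]. *)
Lemma component_representation nu0 : exists h : Rn R n -> R[i],
  [/\ cmeasurable h, Lrho mu P' (fun x => Normc.normc (h x)) &
      forall u, cmeasurable u -> Lrho mu P (fun x => Normc.normc (u x)) ->
        L (single nu0 u) = cintegral (fun x => u x * h x)].
Proof.
have P1 x : 1 < P x by exact: lt_le_trans (Pm x).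
have re_lin (c : R) v1 v2 : Lrho mu P v1 -> Lrho mu P v2 ->
    complex.Re (L (rsingle nu0 (fun x => c * v1 x + v2 x))) =
    c * complex.Re (L (rsingle nu0 v1)) + complex.Re (L (rsingle nu0 v2)).
  by move=> L1 L2; rewrite rsingle_lin// ReD ReM /= mul0r subr0.
have im_lin (c : R) v1 v2 : Lrho mu P v1 -> Lrho mu P v2 ->
    complex.Im (L (rsingle nu0 (fun x => c * v1 x + v2 x))) =
    c * complex.Im (L (rsingle nu0 v1)) + complex.Im (L (rsingle nu0 v2)).
  by move=> L1 L2; rewrite rsingle_lin// ImD ImM /= mul0r addr0.
have [a [ma [sa sa0 aoo] ia aE]] := Lrho_dual mP PM P1
  (l := fun v => complex.Re (L (rsingle nu0 v))) re_lin
  C0 (fun v vL => le_trans (normr_Re_le _) (rsingle_bnd nu0 vL)).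
have [b [mb [sb sb0 boo] ib bE]] := Lrho_dual mP PM P1
  (l := fun v => complex.Im (L (rsingle nu0 v))) im_lin
  C0 (fun v vL => le_trans (normr_Im_le _) (rsingle_bnd nu0 vL)).
pose h x : R[i] := Complex (a x) (b x).
have mh : cmeasurable h by [].
(* Removes the scale left by [Lrho_dual], the conjugate exponent being bounded. *)
have dualL (c : Rn R n -> R) s : measurable_fun setT c -> 0 < s ->
    (\int[mu]_x ((s * `|c x|) `^ (P x / (P x - 1)))%:E < +oo)%E -> Lrho mu P' (fun x => `|c x|).
  move=> mc s0 coo; rewrite (_ : (fun x => `|c x|) = fun x => s^-1 * (s * `|c x|)); last first.
    by apply/funext => x; rewrite mulKf// gt_eqF.
  apply: (LrhoZ mP' P'M); split.
    by apply: measurable_funM => //; exact: measurableT_comp.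
  rewrite rhoE; apply: le_lt_trans coo; rewrite le_eqVlt; apply/orP; left; apply/eqP.
  by apply: eq_integral => x _; rewrite ger0_norm// mulr_ge0// ltW.
have hL : Lrho mu P' (fun x => Normc.normc (h x)).
  apply: (le_Lrho mP' P'M _ (LrhoD mP' P'M (dualL a sa ma sa0 aoo) (dualL b sb mb sb0 boo))).
    exact: measurable_normc.
  by move=> x; rewrite ger0_norm ?normc_ge0// ger0_norm ?addr_ge0//; exact: (normc_le_ReIm (h x)).
exists h; split => // u mu' uL.
pose u1 x := complex.Re (u x); pose u2 x := complex.Im (u x).
have u1L : Lrho mu P u1.
  apply: (le_Lrho mP PM _ uL); first exact: mu'.1.
  by move=> x; rewrite [leRHS]ger0_norm ?normc_ge0// normr_Re_le.
have u2L : Lrho mu P u2.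
  apply: (le_Lrho mP PM _ uL); first exact: mu'.2.
  by move=> x; rewrite [leRHS]ger0_norm ?normc_ge0// normr_Im_le.
have -> : single nu0 u = (Complex 0 1 : R[i]) *: rsingle nu0 u2 + rsingle nu0 u1.
  apply/funext => nu; apply/funext => x; rewrite /rsingle /single.
  rewrite (_ : (_ + _) nu x = (Complex 0 1 : R[i]) * (if nu == nu0 then (fun x => ((u2 x)%:C)%C) else 0) x +
    (if nu == nu0 then (fun x => ((u1 x)%:C)%C) else 0) x)//.
  case: ifP => _ /=; last by rewrite mulr0 addr0.
  apply/eqP; rewrite eq_complex ReD ImD ReM ImM /=.
  by rewrite !mul0r !mul1r !addr0 subr0 !add0r !eqxx.
rewrite L_lin; [|exact: rsingle_mem..].
have a1 : complex.Re (L (rsingle nu0 u1)) = (\int[mu]_x (u1 x * a x))%R := aE _ u1L.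
have a2 : complex.Re (L (rsingle nu0 u2)) = (\int[mu]_x (u2 x * a x))%R := aE _ u2L.
have b1 : complex.Im (L (rsingle nu0 u1)) = (\int[mu]_x (u1 x * b x))%R := bE _ u1L.
have b2 : complex.Im (L (rsingle nu0 u2)) = (\int[mu]_x (u2 x * b x))%R := bE _ u2L.
apply/eqP; rewrite eq_complex ReD ImD ReM ImM a1 a2 b1 b2 /= !mul0r !mul1r !add0r.
apply/andP; split; apply/eqP.
  rewrite addrC -RintegralB//; [|exact: ia|exact: ib].
  by apply: eq_Rintegral => x _; rewrite ReM.
rewrite addrC -RintegralD//; [|exact: ib|exact: ia].
by apply: eq_Rintegral => x _; rewrite ImM.
Qed.

Definition trunc N f := fmul (fun nu => if (nu < N)%N then 1 else 0) f.
Definition tail N f := fmul (fun nu => if (nu < N)%N then 0 else 1) f.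

Let trunc_mem N f : mem f -> mem (trunc N f).
Proof. by apply: fmul_mem => nu; case: ifP; rewrite ?Normc.normc0 ?Normc.normc1. Qed.

Let tail_mem N f : mem f -> mem (tail N f).
Proof. by apply: fmul_mem => nu; case: ifP; rewrite ?Normc.normc0 ?Normc.normc1. Qed.

Let trunc_tail N f : f = trunc N f + tail N f.
Proof.
apply/funext => nu; apply/funext => x.
rewrite (_ : (_ + _) nu x = trunc N f nu x + tail N f nu x)// /trunc /tail /fmul.
by case: ifP => _; rewrite mul1r mul0r ?addr0 ?add0r.
Qed.

Let truncS N f : trunc N.+1 f = single N (f N) + trunc N f.
Proof.
apply/funext => nu; apply/funext => x.
rewrite (_ : (_ + _) nu x = single N (f N) nu x + trunc N f nu x)// /single /trunc /fmul ltnS.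
case: (ltngtP nu N) => [_|_|->]; rewrite ?mul1r ?mul0r ?addr0//.
by rewrite add0r.
Qed.

Let L_trunc N f g : mem f ->
  (forall nu u, cmeasurable u -> Lrho mu P (fun x => Normc.normc (u x)) ->
     L (single nu u) = cintegral (fun x => u x * g nu x)) ->
  L (trunc N f) = \sum_(0 <= nu < N) pairing f g nu.
Proof.
move=> fm gE; have [mf [fL _]] := (memP f).1 fm.
elim: N => [|N IH].
  rewrite big_geq// -[RHS]L0; congr L.
  by apply/funext => nu; apply/funext => x; rewrite /trunc /fmul mul0r.
rewrite truncS (LD (single_mem N (mf N) (fL N)) (trunc_mem N fm)) IH.
by rewrite (gE _ _ (mf N) (fL N)) big_nat_recr//= addrC.
Qed.

(** The device of [l_cvg0] for the mixed modular: tails of a convergent series have modular tending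
    to 0, and the bound at m times the tail, divided by m, makes the affine estimate small. *)
Let L_tail f : mem f -> Normc.normc (L (tail N f)) @[N --> \oo] --> (0 : R).
Proof.
move=> fm; have [mf [fL foo]] := (memP f).1 fm.
have t0 : modf (tail N f) @[N --> \oo] --> 0%E.
  have := mod_seq_tail PM foo (mnc mf); apply: cvg_trans; apply: near_eq_cvg.
  apply: nearW => N; congr mod_seq; apply/funext => nu; apply/funext => x.
  by rewrite /tail /fmul; case: ifP => _; rewrite ?mul0r ?mul1r ?Normc.normc0.
have tmem N := (memP _).1 (tail_mem N fm).
have tfin N : modf (tail N f) \is a fin_num.
  by rewrite ge0_fin_numE ?mod_seq_ge0//; case: (tmem N) => _ [].
have L_le N m : 1 <= m ->
    Normc.normc (L (tail N f)) <= C / m * (1 + m `^ qM * fine (modf (tail N f))).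
  move=> m1; have m0 : 0 < m by rewrite (lt_le_trans ltr01).
  have [mt [_ too]] := tmem N.
  have ncE : nc (((m%:C)%C : R[i]) *: tail N f) = fun nu x => m * Normc.normc (tail N f nu x).
    by apply/funext => nu; apply/funext => x; rewrite -[in RHS](ger0_norm (ltW m0)) -normcZr.
  have := L_mod (cscale_mem m (tail_mem N fm)).
  rewrite LZ; last exact: tail_mem.
  rewrite normcZr gtr0_norm// ncE => h.
  have {}h : ((m * Normc.normc (L (tail N f)))%:E <=
      C%:E * (1 + (m `^ qM)%:E * modf (tail N f)))%E.
    apply: le_trans h _; apply: lee_wpmul2l; first by rewrite lee_fin.
    by rewrite leeD2l// (mod_seq_mul mu mP mQ PM QM (mnc mt) m1).
  rewrite mulrAC ler_pdivlMr// mulrC.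
  rewrite -lee_fin; apply: le_trans h _.
  by rewrite -[X in (_ * (_ + _ * X))%E](fineK (tfin N)).
move: t0 => /fine_cvgP[_ t0]; apply/cvgr0Pnorm_lt => e e0.
pose m := 1 + 2 * C / e.
have m1 : 1 <= m by rewrite lerDl divr_ge0 ?mulr_ge0// ltW.
have m0 : 0 < m by rewrite (lt_le_trans ltr01).
have mp0 : 0 < m `^ qM by rewrite powR_gt0.
have : \forall N \near \oo, `|fine (modf (tail N f))| < (m `^ qM)^-1.
  by apply: (@cvgr0_norm_lt _ _ _ _ _ (fun N => fine (modf (tail N f)))) => //; rewrite invr_gt0.
apply: filterS => N; rewrite ger0_norm ?fine_ge0 ?mod_seq_ge0// => hk.
rewrite ger0_norm ?normc_ge0//; apply: (le_lt_trans (L_le N m m1)).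
have h : 1 + m `^ qM * fine (modf (tail N f)) <= 2.
  by rewrite mulr2n lerD2l// -(divff (lt0r_neq0 mp0)) ler_wpM2l// ltW.
apply: (@le_lt_trans _ _ (C / m * 2)).
  by rewrite ler_wpM2l// divr_ge0// ltW.
rewrite mulrAC ltr_pdivrMr//.
have -> : e * m = e + C * 2 by rewrite /m; field; rewrite gt_eqF.
by rewrite ltrDr.
Qed.

Lemma functional_representation : exists2 g : fseq R n,
  @ns_mem _ (koethe_dual p q) g & forall f, mem f -> canonical_map g f = L f.
Proof.
have /choice[g gP] := component_representation.
have gE nu u : cmeasurable u -> Lrho mu P (fun x => Normc.normc (u x)) ->
  L (single nu u) = cintegral (fun x => u x * g nu x) by case: (gP nu) => _ _; exact.
have gc : conj_mem g by move=> nu; case: (gP nu).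
exists g.
  split.
    move=> nu; apply/(Lp_memP (measurable_conjugate_exponent mp p_ge1) mP' P'M
      (conjugate_exponent_ae pm1 Pm pP)); exact: gc.
  move=> f fm; apply: (@le_lt_trans _ _ (C%:E * norm f)%E); last first.
    by rewrite lte_mul_pinfty ?lee_fin// -ge0_fin_numE ?norm_lqLp_ge0// norm_fin.
  apply: le_abs_pairing => N.
  (* At the rotated sequence L equals the N-th partial sum of absolute pairings, so C times the norm
     of f bounds these sums uniformly in N. *)
  have rm := rotate_mem g N fm.
  have : L (trunc N (rotate f g N)) = ((\sum_(0 <= nu < N) Normc.normc (pairing f g nu))%:C)%C.
    rewrite (L_trunc N rm gE) rmorph_sum /= big_nat [RHS]big_nat.
    by apply: eq_bigr => k /andP[_ kN]; rewrite pairing_rotate// kN.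
  have -> : trunc N (rotate f g N) = rotate f g N.
    apply/funext => nu; apply/funext => x; rewrite /trunc /rotate /fmul.
    by case: ifP => _; rewrite ?mul1r ?mul0r.
  move=> LE; have := L_bnd rm; rewrite LE normc_real ger0_norm; last first.
    by rewrite sumr_ge0// => k _; exact: normc_ge0.
  move=> /le_trans; apply; apply: lee_wpmul2l; first by rewrite lee_fin.
  exact: rotate_norm.
(* The N-th partial sum of the pairings differs from [L f] by the value of L at the tail, up to
   sign. *)
move=> f fm; apply: cseries_sum_unique.
have := L_tail fm; apply: cvg_trans; apply: near_eq_cvg; apply: nearW => N.
have LE : L f = L (trunc N f) + L (tail N f).
  by rewrite -(LD (trunc_mem N fm) (tail_mem N fm)) -trunc_tail.
by rewrite -(L_trunc N fm gE) LE opprD addrA subrr sub0r normcN.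
Qed.

End surjectivity.

End koethe_duality.

(** * Finite representatives of the exponents, and the conclusion *)

Lemma real_exponent d (T : measurableType d) (R : realType)
    (mu : {measure set T -> \bar R}) (p : T -> \bar R) : measurable_fun setT p ->
  (1 < ess_inf mu p < +oo)%E -> (1 < ess_sup mu p < +oo)%E ->
  exists (P : T -> R) (pm pM : R), [/\ measurable_fun setT P, 1 < pm,
    forall x, pm <= P x <= pM & {ae mu, forall x, p x = (P x)%:E}].
Proof.
move=> mp /andP[i1 ioo] /andP[s1 soo].
have iE : ess_inf mu p = (fine (ess_inf mu p))%:E.
  by rewrite fineK// fin_numElt ioo (lt_trans _ i1)// ltNyr.
have sE : ess_sup mu p = (fine (ess_sup mu p))%:E.
  by rewrite fineK// fin_numElt soo (lt_trans _ s1)// ltNyr.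
set pm := fine (ess_inf mu p) in iE; set pS := fine (ess_sup mu p) in sE.
(* Clamping p between its essential bounds changes it on a null set only. Taking [max pm pS] as
   upper bound avoids comparing pm with pS. *)
exists (fun x => Num.max pm (Num.min (fine (p x)) pS)), pm, (Num.max pm pS); split.
- apply: measurable_maxr => //; apply: measurable_minr => //.
  exact: (measurableT_comp (fine_measurable measurableT) mp).
- by rewrite -lte_fin -iE.
- move=> x; rewrite le_max lexx/= ge_max le_max lexx/=.
  by rewrite le_max !ge_min lexx !orbT.
- apply: filterS2 (ess_inf_le mu p) (ess_sup_ge mu p) => x.
  rewrite iE sE; case: (p x) => [r| |]//; rewrite !lee_fin => ir rs /=.
  by rewrite min_l// max_r.
Qed.

Local Open Scope ereal_scope.

Theorem lemma2p4 (R : realType) (n : nat) (hn : (0 < n)%N)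
  (p q : Rn R n -> \bar R)
  (mp : measurable_fun [set: Rn R n] p) (mq : measurable_fun [set: Rn R n] q)
  (p_ge1 : forall x, 1 <= p x) (q_ge1 : forall x, 1 <= q x)
  (p_minus : 1 < ess_inf (lebesgue_Rn R n) p < +oo)
  (q_minus : 1 < ess_inf (lebesgue_Rn R n) q < +oo)
  (p_plus : 1 < ess_sup (lebesgue_Rn R n) p < +oo)
  (q_plus : 1 < ess_sup (lebesgue_Rn R n) q < +oo)
  (hcond :
    [\/ {ae lebesgue_Rn R n, forall x,
          [/\ 1 <= q x, q x <= p x & p x <= +oo]},
        [/\ 1 <= ess_inf (lebesgue_Rn R n) p,
            {ae lebesgue_Rn R n, forall x, q x = ess_sup (lebesgue_Rn R n) q},
            ess_sup (lebesgue_Rn R n) q = ess_inf (lebesgue_Rn R n) q &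
            1 <= ess_inf (lebesgue_Rn R n) q] |
        {ae lebesgue_Rn R n, forall x, (p x)^-1 + (q x)^-1 <= 1}]) :
  @normed_space_iso R (koethe_dual p q) (topological_dual (lqLp p q))
    (@canonical_map R n).
Proof.
have [P [pm [pM [mP pm1 PmM pP]]]] := real_exponent mp p_minus p_plus.
have [Q [qm [qM [mQ qm1 QmM qQ]]]] := real_exponent mq q_minus q_plus.
have QM x : (1 <= Q x <= qM)%R.
  by have /andP[h ->] := QmM x; rewrite (le_trans (ltW qm1)).
have kc g : @ns_mem _ (koethe_dual p q) g -> conj_mem P g.
  exact: (koethe_conj_mem mp mP p_ge1 pm1 PmM pP).
split.
- move=> g gk.
  exact: (canonical_map_bounded mp mP mq mQ p_ge1 q_ge1 pm1 PmM QM pP qQ gk).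
- move=> g1 g2 gk1 gk2 g12 f fm; rewrite /canonical_map; congr cseries_sum.
  apply/funext => nu; rewrite /pairing; apply: ae_eq_cintegral.
  + exact: (pairing_integrable mp mP mq mQ q_ge1 pm1 PmM QM pP qQ nu fm (kc _ gk1)).1.
  + exact: (pairing_integrable mp mP mq mQ q_ge1 pm1 PmM QM pP qQ nu fm (kc _ gk2)).1.
  + by apply: filterS (g12 nu) => x ->.
- move=> a g1 g2 gk1 gk2 f fm.
  exact: (canonical_map_linl mp mP mq mQ p_ge1 q_ge1 pm1 PmM QM pP qQ a fm gk1 gk2).
- move=> g1 g2 gk1 gk2 g12.
  exact: (canonical_map_inj mp mP mq mQ p_ge1 q_ge1 pm1 PmM QM pP qQ gk1 gk2 g12).
- move=> L [L_lin [C LC]].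
  (* The constant in [bounded_linear] carries no sign; its absolute value provides the nonnegative
     one that [functional_representation] expects. *)
  have LC' f : @ns_mem _ (lqLp p q) f ->
      (Normc.normc (L f))%:E <= `|C|%:E * norm_lqLp p q f.
    move=> fm; apply: le_trans (LC f fm) _.
    by apply: lee_wpmul2r; [exact: norm_lqLp_ge0|rewrite lee_fin ler_norm].
  have [g gk gL] := functional_representation mp mP mq mQ p_ge1 q_ge1 pm1 PmM QM
    pP qQ L_lin (normr_ge0 C) LC'.
  by exists g.
- exists 1%R => // g gk; rewrite mul1e; exact: canonical_norm_le.
- exists 1%R => // g gk; rewrite mul1e.
  exact: (koethe_norm_le mp mP mq mQ q_ge1 pm1 PmM QM pP qQ (kc _ gk)).
Qed.
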